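(* Let $\mathbb{K}$ be a commutative ring and let $f,g:\mathcal{S}\to\mathcal{S}'$ be homotopic morphisms of path pairs of sets. Then the induced morphisms of chain complexes over $\mathbb{K}$ are chain homotopic: $$\Omega f\sim\Omega g:\Omega\mathcal{S}\to\Omega\mathcal{S}',\qquad\Psi f\sim\Psi g:\Psi\mathcal{S}\to\Psi\mathcal{S}'.$$
   Context: Graded submodules. For a non-negatively graded chain complex $C$ of $\mathbb{K}$-modules with differential $\partial$ and a graded submodule $D\subseteq C$ (not necessarily a subcomplex), $\omega(C,D)$ is the subcomplex with $\omega(C,D)_n=D_n\cap\partial^{-1}(D_{n-1})$, $\omega'(C,D)$ is the subcomplex with $\omega'(C,D)_n=D_n+\partial(D_{n+1})$, and $\psi(C,D)=C/\omega'(C,D)$. Both $\omega$ and $\psi$ are functorial for chain maps $f:C\to C'$ with $f(D)\subseteq D'$. For a simplicial module $A$, $\mathsf{N}A$ is the Moore complex $\mathsf{N}_nA=\bigcap_{i\ne0}\ker(d_i:A_n\to A_{n-1})$, a subcomplex of the unnormalized complex $\mathsf{C}A$ ($\mathsf{C}_nA=A_n$, differential $\sum_i(-1)^id_i$), and $\rho:\mathsf{C}A\to\mathsf{N}A$ is the projection along the degenerate subcomplex $\mathsf{D}_nA=\sum_is_i(A_{n-1})$. A path pair of sets is $\mathcal{S}=(X,Y)$ where $X$ is a simplicial set and $Y=(Y_n\subseteq X_n)_{n\ge0}$ is a sequence of subsets closed under all degeneracy maps and under the exterior face maps $d_0,d_n:X_n\to X_{n-1}$. A morphism $(X,Y)\to(X',Y')$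 is a simplicial map $f:X\to X'$ with $f(Y)\subseteq Y'$. With $A=\mathbb{K}[X]$ (levelwise free module), $B=\mathbb{K}[Y]$ and $\overline{B}_n=\rho(B_n)\subseteq\mathsf{N}_nA$, put $\Omega\mathcal{S}=\omega(\mathsf{N}A,\overline{B})$ and $\Psi\mathcal{S}=\psi(\mathsf{N}A,\overline{B})$. A $(k,l)$-shuffle is a pair $(\mu,\nu)$ of strictly increasing sequences $\mu=(\mu_0,\dots,\mu_{k-1})$, $\nu=(\nu_0,\dots,\nu_{l-1})$ with $\{\mu_i\}\cup\{\nu_j\}=\{0,\dots,k+l-1\}$; write $s_\nu=s_{\nu_{l-1}}\cdots s_{\nu_0}$, $s_\mu=s_{\mu_{k-1}}\cdots s_{\mu_0}$. The box product is $(X,Y)\square(X',Y')=(X\times X',Y\diamond Y')$ with $$(Y\diamond Y')_n=\bigcup_{k+l=n}\ \bigcup_{(\mu,\nu)\ (k,l)\text{-shuffle}}s_\nu(Y_k)\times s_\mu(Y'_l).$$ Let $I^{\mathsf s}=(\Delta^1,\Delta^1)$ and $\mathsf{pt}^{\mathsf s}=(\Delta^0,\Delta^0)$. The vertex inclusions $d^0,d^1:\Delta^0\to\Delta^1$ induce, via $\mathcal{S}\cong\mathcal{S}\square\mathsf{pt}^{\mathsf s}$, natural morphisms $i^0,i^1:\mathcal{S}\to\mathcal{S}\square I^{\mathsf s}$. Morphisms $f,g:\mathcal{S}\to\mathcal{S}'$ are one-step homotopic if there is a morphism $H:\mathcal{S}\square I^{\mathsf s}\to\mathcal{S}'$ with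 $Hi^0=f$, $Hi^1=g$; they are homotopic if equivalent under the smallest equivalence relation on morphisms $\mathcal{S}\to\mathcal{S}'$ containing one-step homotopy. *)

(* Defs.v *)
From HB Require Import structures.
From Stdlib Require Import Relations.
From mathcomp Require Import all_boot all_order all_algebra.
From mathcomp Require Import finmap boolp classical_sets zify.

Set Implicit Arguments.
Unset Strict Implicit.
Unset Printing Implicit Defensive.

Import GRing.Theory.

Local Open Scope classical_set_scope.
Local Open Scope nat_scope.

(* [mono m n] is the set of morphisms [m] -> [n] of the simplex category,
   with [m] = {0, ..., m} encoded as 'I_m.+1. *)
Record mono (m n : nat) := Mono {
  mono_fun :> {ffun 'I_m.+1 -> 'I_n.+1};
  _ : [forall i : 'I_m.+1, forall j : 'I_m.+1, (i <= j) ==> (mono_fun i <= mono_fun j)] }.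
HB.instance Definition _ m n := [isSub for @mono_fun m n].
HB.instance Definition _ m n := [Choice of mono m n by <:].

Lemma mono_le m n (f : mono m n) (i j : 'I_m.+1) : i <= j -> f i <= f j.
Proof. by case: f => f /= /forallP/(_ i)/forallP/(_ j)/implyP. Qed.

Lemma monoP m n (f g : mono m n) : (forall i, f i = g i :> nat) -> f = g.
Proof. by move=> fg; apply/val_inj/ffunP => i; apply/val_inj/fg. Qed.

Section MkMono.
Variables (m n : nat) (f : 'I_m.+1 -> 'I_n.+1).
Hypothesis f_le : forall i j : 'I_m.+1, i <= j -> f i <= f j.
Fact mkmono_subproof :
  [forall i : 'I_m.+1, forall j : 'I_m.+1, (i <= j) ==> (finfun f i <= finfun f j)].
Proof.
by apply/forallP => i; apply/forallP => j; apply/implyP => ij; rewrite !ffunE f_le.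
Qed.
Definition mkmono : mono m n := Mono mkmono_subproof.
Lemma mkmonoE i : mkmono i = f i. Proof. exact: ffunE. Qed.
End MkMono.

Definition midm n : mono n n := mkmono (f := id) (fun _ _ => id).

Definition mcomp m n p (g : mono n p) (f : mono m n) : mono m p :=
  mkmono (f := fun i => g (f i)) (fun i j ij => mono_le g (mono_le f ij)).

Fact coface_le n (i : 'I_n.+2) (a b : 'I_n.+1) : a <= b -> lift i a <= lift i b.
Proof. by rewrite /= leq_bump2. Qed.
Definition coface n (i : 'I_n.+2) : mono n n.+1 := mkmono (@coface_le n i).

Fact codegen_lt n (i : 'I_n.+1) (a : 'I_n.+2) : unbump i a < n.+1.
Proof. by rewrite /unbump; case: a => a /= ?; case: i => i /= ?; lia. Qed.
Fact codegen_le n (i : 'I_n.+1) (a b : 'I_n.+2) :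
  a <= b -> Ordinal (codegen_lt i a) <= Ordinal (codegen_lt i b).
Proof. by rewrite /= /unbump; lia. Qed.
Definition codegen n (i : 'I_n.+1) : mono n.+1 n := mkmono (@codegen_le n i).

Lemma cofaceE n (i : 'I_n.+2) (a : 'I_n.+1) : coface i a = bump i a :> nat.
Proof. by rewrite mkmonoE. Qed.

Lemma codegenE n (i : 'I_n.+1) (a : 'I_n.+2) : codegen i a = unbump i a :> nat.
Proof. by rewrite mkmonoE. Qed.

Lemma mcompE m n p (g : mono n p) (f : mono m n) i : mcomp g f i = g (f i).
Proof. by rewrite mkmonoE. Qed.

Lemma midmE n i : midm n i = i. Proof. by rewrite mkmonoE. Qed.

Record sset := SSet {
  sob :> nat -> Type;
  sact : forall m n, mono m n -> sob n -> sob m;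
  sact_id : forall n (x : sob n), sact (midm n) x = x;
  sact_comp : forall m n p (g : mono n p) (f : mono m n) (x : sob p),
    sact (mcomp g f) x = sact f (sact g x) }.

Definition sface (X : sset) n (i : 'I_n.+2) : X n.+1 -> X n := sact (coface i).
Definition sdegen (X : sset) n (i : 'I_n.+1) : X n -> X n.+1 := sact (codegen i).

Record smap (X X' : sset) := SMap {
  smap_fun :> forall n, X n -> X' n;
  smap_act : forall m n (u : mono m n) x,
    smap_fun (sact u x) = sact u (smap_fun x) }.

Lemma smap_ext (X X' : sset) (f g : smap X X') : (forall n, f n =1 g n) -> f = g.
Proof.
case: f g => f pf [g pg] /= fg.
have e : f = g by apply: functional_extensionality_dep => n; apply/funext/fg.
by subst g; congr SMap; exact: Prop_irrelevance.
Qed.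

Definition smap_id (X : sset) : smap X X := @SMap X X (fun _ x => x) (fun _ _ _ _ => erefl).

Fact smap_comp_subproof (X Y Z : sset) (g : smap Y Z) (f : smap X Y) m n
  (u : mono m n) x : g m (f m (sact u x)) = sact u (g n (f n x)).
Proof. by rewrite !smap_act. Qed.
Definition smap_comp (X Y Z : sset) (g : smap Y Z) (f : smap X Y) : smap X Z :=
  @SMap X Z (fun n x => g n (f n x)) (smap_comp_subproof g f).

Section StandardSimplex.
Variable p : nat.
Let act m n (u : mono m n) (x : mono n p) : mono m p := mcomp x u.
Fact simplex_id n x : act (midm n) x = x.
Proof. by apply: monoP => i; rewrite mcompE midmE. Qed.
Fact simplex_comp m n q (g : mono n q) (f : mono m n) x :
  act (mcomp g f) x = act f (act g x).
Proof. by apply: monoP => i; rewrite !mcompE. Qed.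
Definition simplex : sset := SSet simplex_id simplex_comp.
End StandardSimplex.

Fact simplex_map_subproof p q (v : mono p q) m n (u : mono m n) (x : simplex p n) :
  mcomp v (sact u x) = sact u (mcomp v x : simplex q n).
Proof. by apply: monoP => i; rewrite !mcompE. Qed.
Definition simplex_map p q (v : mono p q) : smap (simplex p) (simplex q) :=
  @SMap (simplex p) (simplex q) (fun n => @mcomp n p q v) (simplex_map_subproof v).

Section Product.
Variables X X' : sset.
Let act m n (u : mono m n) (x : X n * X' n) : X m * X' m :=
  (sact u x.1, sact u x.2).
Fact sprod_id n x : act (midm n) x = x.
Proof. by case: x => x x'; rewrite /act /= !sact_id. Qed.
Fact sprod_comp m n q (g : mono n q) (f : mono m n) x :
  act (mcomp g f) x = act f (act g x).
Proof. by rewrite /act /= !sact_comp. Qed.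
Definition sprod : sset := SSet sprod_id sprod_comp.
End Product.

Record path_pair := PathPair {
  pp_sset :> sset;
  pp_sub : forall n, set (pp_sset n);
  pp_degen : forall n (i : 'I_n.+1) (x : pp_sset n),
    pp_sub x -> pp_sub (sdegen i x);
  pp_face0 : forall n (x : pp_sset n.+1),
    pp_sub x -> pp_sub (sface ord0 x);
  pp_face_max : forall n (x : pp_sset n.+1),
    pp_sub x -> pp_sub (sface ord_max x) }.

Record pp_map (S S' : path_pair) := PPMap {
  pp_smap :> smap S S';
  pp_mapP : forall n (x : S n), pp_sub x -> pp_sub (pp_smap n x) }.

Lemma pp_map_ext (S S' : path_pair) (f g : pp_map S S') :
  (forall n, f n =1 g n) -> f = g.
Proof.
case: f g => f pf [g pg] /= /smap_ext e.
by subst g; congr PPMap; exact: Prop_irrelevance.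
Qed.

Definition pp_comp (S S' S'' : path_pair) (g : pp_map S' S'') (f : pp_map S S') :
  pp_map S S'' :=
  PPMap (pp_smap := smap_comp g f) (fun n x Yx => pp_mapP g (pp_mapP f Yx)).

Definition pp_id (S : path_pair) : pp_map S S :=
  PPMap (pp_smap := smap_id S) (fun _ _ => id).

Definition shuffle k l (mu : k.-tuple nat) (nu : l.-tuple nat) : Prop :=
  [/\ sorted ltn mu, sorted ltn nu & mu ++ nu =i iota 0 (k + l)].

(* [sdegens nu] is s_{nu (l-1)} ... s_{nu 0}.  The index [inord (nu j)] is
   [nu j] whenever [nu j <= k + j], which holds for the entries of a
   shuffle. *)
Fixpoint sdegens (X : sset) k l (nu : nat -> nat) : X k -> X (l + k) :=
  match l return X k -> X (l + k) with
  | 0 => id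
  | l'.+1 => fun x => sdegen (inord (nu l')) (@sdegens X k l' nu x)
  end.
Arguments sdegens X {k} l nu _.

Definition sdegens_tuple (X : sset) k l (nu : l.-tuple nat) : X k -> X (l + k) :=
  sdegens X l (nth 0 nu).

(* The transports along [l + k = n] and [k + l = n] are identities on the
   underlying simplices. *)
Definition diamond (X X' : sset) (Y : forall n, set (X n))
    (Y' : forall n, set (X' n)) n : set (sprod X X' n) :=
  [set z | exists k l (e : l + k = n) (e' : k + l = n)
             (mu : k.-tuple nat) (nu : l.-tuple nat) (y : X k) (y' : X' l),
     [/\ shuffle mu nu, Y k y, Y' l y' &
         z = (ecast i (X i) e (sdegens_tuple nu y),
              ecast i (X' i) e' (sdegens_tuple mu y'))]].

Lemma sdegens_smap (X X' : sset) (f : smap X X') k l nu (x : X k) :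
  f _ (sdegens X l nu x) = sdegens X' l nu (f _ x).
Proof. by elim: l => [//|l IH] /=; rewrite smap_act IH. Qed.

(* The monotone map underlying an iterated degeneracy sends t to the number
   of elements of {0, ..., t - 1} not among the nu j. *)
Definition codegens_nat (l : nat) (nu : nat -> nat) (t : nat) :=
  t - \sum_(j < l) (nu j < t).

Lemma codegens_natS l nu t :
  (forall i j, i < j -> j < l.+1 -> nu i < nu j) ->
  codegens_nat l nu (unbump (nu l) t) = codegens_nat l.+1 nu t.
Proof.
move=> nu_lt; rewrite /codegens_nat big_ord_recr /= /unbump.
have [lt_t|le_t] := ltnP (nu l) t; last by rewrite subn0 addn0.
have E (s : nat) : nu l <= s -> \sum_(j < l) (nu j < s) = l.
  move=> le_s; rewrite (eq_bigr (fun=> 1)) ?sum1_card ?card_ord // => j _.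
  by rewrite (leq_trans (nu_lt j l _ _) le_s).
by rewrite !E; lia.
Qed.

Lemma sdegensE (X : sset) k l nu (x : X k) :
  (forall i j, i < j -> j < l -> nu i < nu j) ->
  (forall j, j < l -> nu j <= j + k) ->
  exists2 u : mono (l + k) k,
    (forall t, val (u t) = codegens_nat l nu t) & sdegens X l nu x = sact u x.
Proof.
elim: l => [|l IH] nu_lt nu_bd.
  exists (midm k); last by rewrite /= sact_id.
  by move=> t; rewrite midmE /codegens_nat big_ord0 subn0.
have [i j ij jl|j jl|u uE IHx] := IH; first exact: nu_lt (ltnW _).
  by apply: nu_bd; lia.
exists (mcomp u (codegen (inord (nu l)))); last by rewrite sact_comp -IHx.
move=> t; rewrite mcompE uE codegenE inordK; last by rewrite ltnS nu_bd.
by rewrite codegens_natS.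
Qed.

Lemma count_sum (s : seq nat) l t : size s = l ->
  \sum_(j < l) (nth 0 s j < t) = count (fun i => i < t) s.
Proof.
move=> <-; rewrite -sum1_count [RHS](big_nth 0) big_mkord [RHS]big_mkcond.
by apply: eq_bigr => i _; case: ltnP.
Qed.

Lemma sorted_ltn_nth (s : seq nat) i j :
  sorted ltn s -> i < j -> j < size s -> nth 0 s i < nth 0 s j.
Proof.
by move=> ss ij js; apply: (sorted_ltn_nth ltn_trans) => //; rewrite inE; lia.
Qed.

Lemma sorted_ltn_bound (s : seq nat) n :
  sorted ltn s -> (forall i, i \in s -> i < n) ->
  forall j, j < size s -> nth 0 s j + (size s - j) <= n.
Proof.
move=> ss sn j js.
have {}js := js; have [d dE] : exists d, size s = j + d.+1.
  by exists (size s - j.+1); lia.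
rewrite dE addKn; elim: d j js dE => [|d IH] j js dE.
  by rewrite addn1; apply: sn; exact: mem_nth.
have js1 : j.+1 < size s by lia.
have dE1 : size s = j.+1 + d.+1 by lia.
by have := IH _ js1 dE1; have := sorted_ltn_nth ss (ltnSn j) js1; lia.
Qed.

Lemma sdegens_tupleE (X : sset) k l (nu : l.-tuple nat) (x : X k) :
  sorted ltn nu -> (forall i, i \in nu -> i < l + k) ->
  exists2 u : mono (l + k) k,
    (forall t, val (u t) = t - count (fun i => i < t) nu)
    & sdegens_tuple nu x = sact u x.
Proof.
move=> ss sn; rewrite /sdegens_tuple; have [||u uE ->] := @sdegensE X k l (nth 0 nu) x.
- by move=> i j ij jl; apply: sorted_ltn_nth; rewrite ?size_tuple.
- move=> j jl; have := sorted_ltn_bound ss sn (j := j).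
  by rewrite size_tuple => /(_ jl); lia.
by exists u => // t; rewrite uE /codegens_nat count_sum ?size_tuple.
Qed.

Lemma shuffle_perm k l (mu : k.-tuple nat) (nu : l.-tuple nat) :
  shuffle mu nu -> perm_eq (mu ++ nu) (iota 0 (k + l)).
Proof.
case=> _ _ E; apply: (uniq_perm _ (iota_uniq _ _) E).
apply: (@leq_size_uniq _ (iota 0 (k + l))); first exact: iota_uniq.
  by move=> i; rewrite E.
by rewrite size_cat !size_tuple.
Qed.

Lemma count_lt_iota n t : t <= n -> count (fun i => i < t) (iota 0 n) = t.
Proof.
move=> tn; rewrite -(subnKC tn) iotaD count_cat add0n.
have /eqP -> : count (fun i => i < t) (iota 0 t) == size (iota 0 t).
  by rewrite -all_count; apply/allP => i; rewrite mem_iota.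
have /eqP -> : count (fun i => i < t) (iota t (n - t)) == 0.
  by rewrite -leqn0 leqNgt -has_count; apply/hasPn => i; rewrite mem_iota; lia.
by rewrite size_iota addn0.
Qed.

(* Shuffles are the same thing as maximal chains in [k] x [l]. *)
Lemma diamondP (X X' : sset) (Y : forall n, set (X n)) (Y' : forall n, set (X' n))
    n (z : sprod X X' n) :
  diamond Y Y' z <->
  exists k l (u : mono n k) (v : mono n l) (y : X k) (y' : X' l),
    [/\ k + l = n, forall t : 'I_n.+1, u t + v t = t, Y k y, Y' l y' &
        z = (sact u y, sact v y')].
Proof.
split.
  case=> k [l [e [e' [mu [nu [y [y' [sh Yy Yy' ->]]]]]]]].
  have pe := shuffle_perm sh; case: sh => smu snu mnE.
  have [i ni|u uE ->] := sdegens_tupleE y snu.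
    by have := mnE i; rewrite mem_cat ni orbT mem_iota; lia.
  have [i mi|v vE ->] := sdegens_tupleE y' smu.
    by have := mnE i; rewrite mem_cat mi mem_iota; lia.
  exists k, l, (ecast i (mono i k) e u), (ecast i (mono i l) e' v), y, y'.
  split=> //; last first.
    by congr pair; [case: _ / e | case: _ / e'].
  have {}uE (t : 'I_n.+1) : val ((ecast i (mono i k) e u) t) = t - count (fun i => i < t) nu.
    by case: _ / e t => t /=; exact: uE.
  have {}vE (t : 'I_n.+1) : val ((ecast i (mono i l) e' v) t) = t - count (fun i => i < t) mu.
    by case: _ / e' {uE} t => t /=; exact: vE.
  move=> t; rewrite uE vE.
  have tn : t <= k + l by have := ltn_ord t; lia.
  have := count_lt_iota tn.
  rewrite -(permP pe) count_cat.
  by move: (count _ mu) (count _ nu) => a b; lia.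
case=> k [l [u [v [y [y' [kl uv Yy Yy' ->]]]]]].
pose p i := nat_of_ord (u (inord i)); pose q i := nat_of_ord (v (inord i)).
have pq i : i <= n -> p i + q i = i.
  by move=> i_n; rewrite /p /q uv inordK.
have pS i : i < n -> p i <= p i.+1.
  by move=> i_n; apply: mono_le; rewrite !inordK; lia.
have qS i : i < n -> q i <= q i.+1.
  by move=> i_n; apply: mono_le; rewrite !inordK; lia.
have pk i : p i <= k by rewrite -ltnS ltn_ord.
have ql i : q i <= l by rewrite -ltnS ltn_ord.
pose mu := [seq i <- iota 0 n | p i.+1 != p i].
pose nu := [seq i <- iota 0 n | ~~ (p i.+1 != p i)].
have cnt t : t <= n -> count (fun i => i < t) mu = p t /\ count (fun i => i < t) nu = q t.
  move=> tn.
  have E (a : pred nat) : count (fun i => i < t) [seq i <- iota 0 n | a i] = count a (iota 0 t).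
    rewrite count_filter -(subnKC tn) iotaD count_cat add0n addnC.
    have /eqP -> : count (predI (fun i => i < t) a) (iota t (n - t)) == 0.
      by rewrite -leqn0 leqNgt -has_count; apply/hasPn => i; rewrite mem_iota /=; lia.
    by apply: eq_in_count => i; rewrite mem_iota /= => ->.
  rewrite !E; elim: t tn {E} => [|t IH] tn.
    by have := pq 0 isT; rewrite /=; lia.
  rewrite -addn1 iotaD !count_cat add0n.
  case: (IH (ltnW tn)) => -> -> /=; rewrite addn1.
  have := pq _ tn; have := pq _ (ltnW tn); have := pS _ tn; have := qS _ tn.
  by case: (p t.+1 =P p t) => /=; lia.
have lt_mu i : i \in mu -> i < n by rewrite mem_filter mem_iota; lia.
have lt_nu i : i \in nu -> i < n by rewrite mem_filter mem_iota; lia.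
have cn (s : seq nat) : (forall i, i \in s -> i < n) -> count (fun i => i < n) s = size s.
  by move=> sn; apply/eqP; rewrite -all_count; apply/allP => i /sn.
have [] := cnt _ (leqnn n); rewrite !cn // => smu snu.
have /eqP {}smu : size mu == k by move: (pq n) (pk n) (ql n); lia.
have /eqP {}snu : size nu == l by move: (pq n) (pk n) (ql n) (cnt _ (leqnn n)); rewrite !cn //; lia.
have smuE := introT eqP smu; have snuE := introT eqP snu.
have sort_iota : sorted ltn (iota 0 n) by exact: iota_ltn_sorted.
have so_mu : sorted ltn mu by apply: sorted_filter sort_iota; exact: ltn_trans.
have so_nu : sorted ltn nu by apply: sorted_filter sort_iota; exact: ltn_trans.
have lk : l + k = n by rewrite addnC.
have [i /lt_nu|u' u'E u'y] := @sdegens_tupleE X k l (Tuple snuE) y so_nu.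
  by rewrite lk.
have [i /lt_mu|v' v'E v'y] := @sdegens_tupleE X' l k (Tuple smuE) y' so_mu.
  by rewrite kl.
exists k, l, lk, kl, (Tuple smuE), (Tuple snuE), y, y'; split => //.
  split => // i; rewrite kl mem_cat !mem_filter -andb_orl.
  by case: (p i.+1 == p i).
rewrite u'y v'y.
have -> : u = ecast i (mono i k) lk u'.
  apply: monoP => t.
  have -> : nat_of_ord ((ecast i (mono i k) lk u') t) = t - count (fun i => i < t) nu.
    by clear -u'E; case: _ / lk t => t; exact: u'E.
  have tn : t <= n by rewrite -ltnS ltn_ord.
  have [_ ->] := cnt _ tn; have := pq _ tn; rewrite /p /q !inord_val; lia.
have -> : v = ecast i (mono i l) kl v'.
  apply: monoP => t.
  have -> : nat_of_ord ((ecast i (mono i l) kl v') t) = t - count (fun i => i < t) mu.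
    by clear -v'E; case: _ / kl t => t; exact: v'E.
  have tn : t <= n by rewrite -ltnS ltn_ord.
  have [-> _] := cnt _ tn; have := pq _ tn; rewrite /p /q !inord_val; lia.
by congr pair; [case: _ / lk | case: _ / kl].
Qed.

Section BoxClosed.
Variables S S' : path_pair.
Let Y := @diamond S S' (@pp_sub S) (@pp_sub S').

Fact box_degen n (i : 'I_n.+1) (z : sprod S S' n) : Y z -> Y (sdegen i z).
Proof.
move=> /diamondP [k [l [u [v [y [y' [kl uv Yy Yy' ->]]]]]]].
have u'_lt (t : 'I_n.+2) : u (codegen i t) + (i < t) < k.+2.
  by have := ltn_ord (u (codegen i t)); case: (i < t); lia.
have u'_le (s t : 'I_n.+2) : s <= t -> Ordinal (u'_lt s) <= Ordinal (u'_lt t).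
  move=> st /=; apply: leq_add; first exact: (mono_le u (mono_le (codegen i) st)).
  by case: (ltnP i s) => // lt_is; rewrite (leq_trans lt_is st).
have u'E t : mkmono u'_le t = u (codegen i t) + (i < t) :> nat by rewrite mkmonoE.
apply/diamondP; exists k.+1, l, (mkmono u'_le), (mcomp v (codegen i)),
  (sdegen (u i) y), y'; split=> //.
- by lia.
- move=> t; rewrite u'E mcompE addnAC uv codegenE /unbump.
  by case: (ltnP i t); lia.
- exact: pp_degen.
rewrite /sdegen -sact_comp /=; congr pair; last by rewrite sact_comp.
rewrite -sact_comp; congr (sact _ y); apply: monoP => t.
rewrite !mcompE codegenE u'E /unbump.
have [lt_it|le_ti] := ltnP i t.
  suff : u i <= u (codegen i t) by lia.
  by apply: mono_le; rewrite codegenE /unbump; lia.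
suff : u (codegen i t) <= u i by lia.
by apply: mono_le; rewrite codegenE /unbump; lia.
Qed.

Fact box_face0 n (z : sprod S S' n.+1) : Y z -> Y (sface ord0 z).
Proof.
move=> /diamondP [k [l [u [v [y [y' [kl uv Yy Yy' ->]]]]]]].
pose d0 : mono n n.+1 := coface ord0.
have d0E t : d0 t = t.+1 :> nat by rewrite cofaceE.
have uv0 : u (d0 ord0) + v (d0 ord0) = 1 by rewrite uv d0E.
have [u0|u0] : (u (d0 ord0) == 1 :> nat) \/ (v (d0 ord0) == 1 :> nat).
- by move: (nat_of_ord (u _)) (nat_of_ord (v _)) uv0 => a b; lia.
- case: k u kl uv y Yy uv0 u0 => [|k] u kl uv y Yy uv0 u0.
    by have := ltn_ord (u (d0 ord0)); rewrite (eqP u0).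
  have u'_lt (t : 'I_n.+1) : (u (d0 t)).-1 < k.+1.
    by have := ltn_ord (u (d0 t)); lia.
  have u'_le (s t : 'I_n.+1) : s <= t -> Ordinal (u'_lt s) <= Ordinal (u'_lt t).
    by move=> st; rewrite /= -!subn1; apply: leq_sub2r; exact: (mono_le u (mono_le d0 st)).
  have u'E t : mkmono u'_le t = (u (d0 t)).-1 :> nat by rewrite mkmonoE.
  have u_gt0 t : 0 < u (d0 t).
    by rewrite -(eqP u0); apply: mono_le; rewrite !d0E.
  apply/diamondP; exists k, l, (mkmono u'_le), (mcomp v d0), (sface ord0 y), y'.
  split => //.
  + by lia.
  + move=> t; rewrite u'E mcompE; have := uv (d0 t); have := u_gt0 t.
    by rewrite d0E; move: (nat_of_ord (u _)) (nat_of_ord (v _)) => a b; lia.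
  + exact: pp_face0.
  rewrite /sface /= -!sact_comp; congr (sact _ y, _); apply: monoP => t.
  by rewrite !mcompE cofaceE u'E /bump /= add1n prednK.
- case: l v kl uv y' Yy' uv0 u0 => [|l] v kl uv y' Yy' uv0 u0.
    by have := ltn_ord (v (d0 ord0)); rewrite (eqP u0).
  have v'_lt (t : 'I_n.+1) : (v (d0 t)).-1 < l.+1.
    by have := ltn_ord (v (d0 t)); lia.
  have v'_le (s t : 'I_n.+1) : s <= t -> Ordinal (v'_lt s) <= Ordinal (v'_lt t).
    by move=> st; rewrite /= -!subn1; apply: leq_sub2r; exact: (mono_le v (mono_le d0 st)).
  have v'E t : mkmono v'_le t = (v (d0 t)).-1 :> nat by rewrite mkmonoE.
  have v_gt0 t : 0 < v (d0 t).
    by rewrite -(eqP u0); apply: mono_le; rewrite !d0E.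
  apply/diamondP; exists k, l, (mcomp u d0), (mkmono v'_le), y, (sface ord0 y').
  split => //.
  + by lia.
  + move=> t; rewrite v'E mcompE; have := uv (d0 t); have := v_gt0 t.
    by rewrite d0E; move: (nat_of_ord (u _)) (nat_of_ord (v _)) => a b; lia.
  + exact: pp_face0.
  rewrite /sface /= -!sact_comp; congr (_, sact _ y'); apply: monoP => t.
  by rewrite !mcompE cofaceE v'E /bump /= add1n prednK.
Qed.

Fact box_face_max n (z : sprod S S' n.+1) : Y z -> Y (sface ord_max z).
Proof.
move=> /diamondP [k [l [u [v [y [y' [kl uv Yy Yy' ->]]]]]]].
pose dn : mono n n.+1 := coface ord_max.
have dnE t : dn t = t :> nat.
  by rewrite cofaceE /bump /= leqNgt ltn_ord.
have uvn : u (dn ord_max) + v (dn ord_max) = n by rewrite uv dnE.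
have ule := ltn_ord (u (dn ord_max)); have vle := ltn_ord (v (dn ord_max)).
have [u0|u0] : (u (dn ord_max) < k) \/ (v (dn ord_max) < l).
- by move: (nat_of_ord (u _)) (nat_of_ord (v _)) ule vle uvn => a b; lia.
- case: k u kl uv y Yy uvn ule u0 => [|k] u kl uv y Yy uvn ule u0.
    by rewrite ltn0 in u0.
  have u'_lt (t : 'I_n.+1) : u (dn t) < k.+1.
    by apply: leq_ltn_trans u0; apply: mono_le; rewrite !dnE -ltnS ltn_ord.
  have u'_le (s t : 'I_n.+1) : s <= t -> Ordinal (u'_lt s) <= Ordinal (u'_lt t).
    by move=> st; exact: (mono_le u (mono_le dn st)).
  have u'E t : mkmono u'_le t = u (dn t) :> nat by rewrite mkmonoE.
  apply/diamondP; exists k, l, (mkmono u'_le), (mcomp v dn), (sface ord_max y), y'.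
  split => //.
  + by lia.
  + by move=> t; rewrite u'E mcompE uv dnE.
  + exact: pp_face_max.
  rewrite /sface /= -!sact_comp; congr (sact _ y, _); apply: monoP => t.
  by rewrite !mcompE cofaceE u'E /bump /= [k.+1 <= _]leqNgt u'_lt.
- case: l v kl uv y' Yy' uvn vle u0 => [|l] v kl uv y' Yy' uvn vle u0.
    by rewrite ltn0 in u0.
  have v'_lt (t : 'I_n.+1) : v (dn t) < l.+1.
    by apply: leq_ltn_trans u0; apply: mono_le; rewrite !dnE -ltnS ltn_ord.
  have v'_le (s t : 'I_n.+1) : s <= t -> Ordinal (v'_lt s) <= Ordinal (v'_lt t).
    by move=> st; exact: (mono_le v (mono_le dn st)).
  have v'E t : mkmono v'_le t = v (dn t) :> nat by rewrite mkmonoE.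
  apply/diamondP; exists k, l, (mcomp u dn), (mkmono v'_le), y, (sface ord_max y').
  split => //.
  + by lia.
  + by move=> t; rewrite v'E mcompE uv dnE.
  + exact: pp_face_max.
  rewrite /sface /= -!sact_comp; congr (_, sact _ y'); apply: monoP => t.
  by rewrite !mcompE cofaceE v'E /bump /= [l.+1 <= _]leqNgt v'_lt.
Qed.

Definition box : path_pair := PathPair box_degen box_face0 box_face_max.
End BoxClosed.

Section BoxMap.
Variables (S S' T T' : path_pair) (f : pp_map S T) (g : pp_map S' T').
Let h n (z : box S S' n) : box T T' n := (f n z.1, g n z.2).
Fact box_map_act m n (u : mono m n) z : h (sact u z) = sact u (h z).
Proof. by rewrite /h /= !smap_act. Qed.
Fact box_map_sub n (z : box S S' n) :
  pp_sub z -> pp_sub (SMap box_map_act n z).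
Proof.
move=> /diamondP [k [l [u [v [y [y' [kl uv Yy Yy' ->]]]]]]].
apply/diamondP; exists k, l, u, v, (f k y), (g l y'); split=> //.
- exact: pp_mapP.
- exact: pp_mapP.
by rewrite /= /h /= !smap_act.
Qed.
Definition box_map : pp_map (box S S') (box T T') := PPMap box_map_sub.
End BoxMap.

Definition simplex_pp (p : nat) : path_pair :=
  @PathPair (simplex p) (fun _ => setT) (fun _ _ _ _ => I)
    (fun _ _ _ => I) (fun _ _ _ => I).

Definition simplex_pp_map p q (v : mono p q) : pp_map (simplex_pp p) (simplex_pp q) :=
  @PPMap (simplex_pp p) (simplex_pp q) (simplex_map v) (fun _ _ _ => I).

Definition pt_pp : path_pair := simplex_pp 0.
Definition interval_pp : path_pair := simplex_pp 1.

Lemma simplex0_eq n (x y : simplex 0 n) : x = y.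
Proof. by apply: monoP => i; rewrite !ord1. Qed.

Definition pt_simplex n : simplex 0 n :=
  mkmono (f := fun=> ord0) (fun _ _ _ => leqnn 0).

Section BoxUnit.
Variable S : path_pair.
Let h n (x : S n) : box S pt_pp n := (x, pt_simplex n).
Fact box_unit_act m n (u : mono m n) x : h (sact u x) = sact u (h x).
Proof. by congr pair; exact: simplex0_eq. Qed.
Fact box_unit_sub n (x : S n) : pp_sub x -> pp_sub (SMap box_unit_act n x).
Proof.
move=> Yx; apply/diamondP.
exists n, 0, (midm n), (pt_simplex n), x, (pt_simplex 0); split=> //.
- by rewrite addn0.
- by move=> t; rewrite midmE mkmonoE addn0.
- by congr pair; [rewrite sact_id | exact: simplex0_eq].
Qed.
Definition box_unit : pp_map S (box S pt_pp) := PPMap box_unit_sub.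

Definition box_unit_inv_smap : smap (box S pt_pp) S :=
  @SMap (box S pt_pp) S (fun _ z => z.1) (fun _ _ _ _ => erefl).
Fact box_unit_inv_sub n (z : box S pt_pp n) :
  pp_sub z -> pp_sub (box_unit_inv_smap n z).
Proof.
move=> [k [l [e [e' [mu [nu [y [y' [_ Yy _ ->]]]]]]]]] /=.
case: _ / e {e' mu}; rewrite /sdegens_tuple; move: (nth 0 nu) => {}nu.
by elim: l {y'} => [//|l IH]; exact: pp_degen.
Qed.
Definition box_unit_inv : pp_map (box S pt_pp) S := PPMap box_unit_inv_sub.

Lemma box_unitK : pp_comp box_unit_inv box_unit = pp_id S.
Proof. exact: pp_map_ext. Qed.
Lemma box_unit_invK : pp_comp box_unit box_unit_inv = pp_id (box S pt_pp).
Proof.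
apply: pp_map_ext => n [x y]; rewrite /= /h /=.
by rewrite (simplex0_eq (pt_simplex n) y).
Qed.
End BoxUnit.

(* [interval_incl S e] is S = S [] pt -> S [] I, induced by the coface
   d^e : Delta^0 -> Delta^1; its image is the vertex of Delta^1 other
   than e. *)
Definition interval_incl (S : path_pair) (e : 'I_2) : pp_map S (box S interval_pp) :=
  pp_comp (box_map (pp_id S) (simplex_pp_map (coface e))) (box_unit S).

Definition one_step_homotopic (S S' : path_pair) (f g : pp_map S S') : Prop :=
  exists H : pp_map (box S interval_pp) S',
    pp_comp H (interval_incl S ord0) = f /\ pp_comp H (interval_incl S ord_max) = g.

Definition homotopic (S S' : path_pair) : pp_map S S' -> pp_map S S' -> Prop :=
  clos_refl_sym_trans _ (@one_step_homotopic S S').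

Local Open Scope ring_scope.

Section FreeModule.
Variables (K : pzRingType) (T : Type).

(* K[T], as the finitely supported functions on T. *)
Definition freemod : Type := {fsfun {classic T} -> K with 0}.
HB.instance Definition _ := Choice.on freemod.
Definition coef (a : freemod) (x : T) : K := (a : {fsfun {classic T} -> K with 0}) x.

Definition fsupp (a : freemod) : {fset {classic T}} := finsupp a.

Lemma freeP (a b : freemod) : coef a =1 coef b -> a = b.
Proof. by move=> ab; apply/fsfunP. Qed.

Lemma fsuppP (a : freemod) (x : T) : ((x : {classic T}) \in fsupp a) = (coef a x != 0).
Proof. exact: mem_finsupp. Qed.

Definition fbasis (x : T) : freemod := [fsfun y in [fset (x : {classic T})]%fset => 1 | 0].
Definition fzero : freemod := [fsfun].
Definition fopp (a : freemod) : freemod := [fsfun x in fsupp a => - coef a x | 0].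
Definition fadd (a b : freemod) : freemod :=
  [fsfun x in (fsupp a `|` fsupp b)%fset => coef a x + coef b x | 0].
Definition fscale (c : K) (a : freemod) : freemod := [fsfun x in fsupp a => c * coef a x | 0].

Lemma coef_basis x y : coef (fbasis x) y = ((y : {classic T}) == x)%:R.
Proof. by rewrite /coef fsfunE inE; case: eqP. Qed.
Fact coef0_subproof x : coef fzero x = 0. Proof. by rewrite /coef fsfun0E. Qed.
Fact coefN_subproof a x : coef (fopp a) x = - coef a x.
Proof. by rewrite [LHS]fsfunE fsuppP; case: eqP => //= ->; rewrite oppr0. Qed.
Fact coefD_subproof a b x : coef (fadd a b) x = coef a x + coef b x.
Proof.
rewrite [LHS]fsfunE inE !fsuppP.
by case: eqP => //= ->; case: eqP => //= ->; rewrite addr0.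
Qed.
Fact coefZ_subproof c a x : coef (fscale c a) x = c * coef a x.
Proof. by rewrite [LHS]fsfunE fsuppP; case: eqP => //= ->; rewrite mulr0. Qed.
Let fE := (coef0_subproof, coefN_subproof, coefD_subproof, coefZ_subproof).

Fact faddA : associative fadd.
Proof. by move=> a b c; apply: freeP => x; rewrite !fE addrA. Qed.
Fact faddC : commutative fadd.
Proof. by move=> a b; apply: freeP => x; rewrite !fE addrC. Qed.
Fact fadd0 : left_id fzero fadd.
Proof. by move=> a; apply: freeP => x; rewrite !fE add0r. Qed.
Fact faddN : left_inverse fzero fopp fadd.
Proof. by move=> a; apply: freeP => x; rewrite !fE addNr. Qed.
HB.instance Definition _ := GRing.isZmodule.Build freemod faddA faddC fadd0 faddN.

Fact fscaleA c d a : fscale c (fscale d a) = fscale (c * d) a.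
Proof. by apply: freeP => x; rewrite !fE mulrA. Qed.
Fact fscale1 : left_id 1 fscale.
Proof. by move=> a; apply: freeP => x; rewrite !fE mul1r. Qed.
Fact fscaleDr : right_distributive fscale +%R.
Proof. by move=> c a b; apply: freeP => x; rewrite !fE mulrDr. Qed.
Fact fscaleDl a : {morph fscale^~ a : c d / c + d}.
Proof. by move=> c d; apply: freeP => x; rewrite !fE mulrDl. Qed.
HB.instance Definition _ := GRing.Zmodule_isLmodule.Build K freemod
  fscaleA fscale1 fscaleDr fscaleDl.

Lemma coef0 x : coef 0 x = 0. Proof. exact: coef0_subproof. Qed.
Lemma coefN a x : coef (- a) x = - coef a x. Proof. exact: coefN_subproof. Qed.
Lemma coefD a b x : coef (a + b) x = coef a x + coef b x.
Proof. exact: coefD_subproof. Qed.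
Lemma coefZ c a x : coef (c *: a) x = c * coef a x. Proof. exact: coefZ_subproof. Qed.
Lemma coef_sum I (r : seq I) (P : pred I) (F : I -> freemod) x :
  coef (\sum_(i <- r | P i) F i) x = \sum_(i <- r | P i) coef (F i) x.
Proof.
exact: (big_morph (coef^~ x) (fun a b => coefD a b x) (coef0 x)).
Qed.

Lemma free_sumE (a : freemod) (A : {fset {classic T}}) : (fsupp a `<=` A)%fset ->
  a = \sum_(x <- A) coef a x *: fbasis x.
Proof.
move=> /fsubsetP aA; apply: freeP => y; rewrite coef_sum.
have [yA|yA] := boolP ((y : {classic T}) \in A).
  rewrite (bigD1_seq (y : {classic T})) ?fset_uniq // coefZ coef_basis eqxx mulr1.
  rewrite big1; first by rewrite [RHS]addr0.
  by move=> x xy; rewrite coefZ coef_basis eq_sym (negbTE xy) mulr0.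
have /eqP -> : coef a y == 0.
  by apply: contraNT yA => ya; apply: aA; rewrite fsuppP.
rewrite big_seq big1 // => x xA; rewrite coefZ coef_basis.
by case: eqP => [yx|]; [rewrite yx xA in yA | rewrite mulr0].
Qed.

Section Lift.
Variables (V : lmodType K) (f : T -> V).
Definition flift (a : freemod) : V := \sum_(x <- fsupp a) coef a x *: f x.

Lemma flift_sumE (a : freemod) (A : {fset {classic T}}) : (fsupp a `<=` A)%fset ->
  flift a = \sum_(x <- A) coef a x *: f x.
Proof.
move=> aA; apply: big_fset_incl => // x _; rewrite fsuppP negbK => /eqP ->.
by rewrite scale0r.
Qed.

Fact flift_is_linear : linear flift.
Proof.
move=> c a b; pose A := (fsupp (c *: a + b)%R `|` fsupp a `|` fsupp b)%fset.
rewrite !(@flift_sumE _ A) ?scaler_sumr -?big_split /=.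
- by apply: eq_bigr => x _; rewrite coefD coefZ scalerDl scalerA.
- exact: fsubsetUr.
- by rewrite /A -fsetUA fsetUCA fsubsetUl.
- by rewrite /A -fsetUA fsubsetUl.
Qed.
HB.instance Definition _ := GRing.isLinear.Build K freemod V _ flift flift_is_linear.

Lemma flift_basis x : flift (fbasis x) = f x.
Proof.
rewrite (@flift_sumE _ [fset (x : {classic T})]%fset).
  by rewrite big_seq_fset1 coef_basis eqxx scale1r.
apply/fsubsetP => y; rewrite fsuppP coef_basis inE.
by case: (y == x) => //; rewrite eqxx.
Qed.
End Lift.

Lemma linear_freeP (V : lmodType K) (f g : {linear freemod -> V}) :
  (forall x, f (fbasis x) = g (fbasis x)) -> f =1 g.
Proof.
move=> fg a; rewrite (free_sumE (fsubset_refl (fsupp a))) !linear_sum.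
by apply: eq_bigr => x _; rewrite !linearZ /= fg.
Qed.

Definition free_sub (Y : set T) : {pred freemod} :=
  [pred a | `[< forall x, coef a x != 0 -> Y x >]].

Lemma free_subP (Y : set T) (a : freemod) :
  reflect (forall x, coef a x != 0 -> Y x) (a \in free_sub Y).
Proof. exact: asboolP. Qed.

Fact free_sub_closed (Y : set T) : submod_closed (free_sub Y).
Proof.
split; first by apply/free_subP => x; rewrite coef0 eqxx.
move=> c a b /free_subP aY /free_subP bY; apply/free_subP => x.
rewrite coefD coefZ; have [->|/aY //] := eqVneq (coef a x) 0.
by rewrite mulr0 add0r; apply: bY.
Qed.
HB.instance Definition _ (Y : set T) :=
  GRing.isSubmodClosed.Build K freemod (free_sub Y) (free_sub_closed Y).

Lemma fbasis_sub (Y : set T) x : Y x -> fbasis x \in free_sub Y.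
Proof.
move=> Yx; apply/free_subP => y; rewrite coef_basis.
by case: (y =P x :> {classic T}) => [->|]; rewrite ?eqxx.
Qed.

End FreeModule.

Arguments fbasis K {T} x.
Arguments free_sub K {T} Y.

Definition free_map (K : pzRingType) (T T' : Type) (f : T -> T') :
  {linear freemod K T -> freemod K T'} := flift (fun x => fbasis K (f x)).

Lemma free_map_basis (K : pzRingType) (T T' : Type) (f : T -> T') x :
  free_map K f (fbasis K x) = fbasis K (f x).
Proof. exact: flift_basis. Qed.

Lemma free_map_sub (K : pzRingType) (T T' : Type) (f : T -> T') (Y : set T) (Y' : set T') :
  (forall x, Y x -> Y' (f x)) ->
  forall a, a \in free_sub K Y -> free_map K f a \in free_sub K Y'.
Proof.
move=> fY a /free_subP aY; rewrite [free_map K f a]/(flift _ a) /flift.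
rewrite big_seq; apply: rpred_sum => x; rewrite fsuppP => /aY /fY Yfx.
exact/rpredZ/fbasis_sub.
Qed.

Section Submodule.
Variables (K : pzRingType) (V : lmodType K) (S : submodClosed V).
Record subm := Subm { subm_val :> V; _ : subm_val \in S }.
HB.instance Definition _ := [isSub for subm_val].
HB.instance Definition _ := [Choice of subm by <:].
HB.instance Definition _ := [SubChoice_isSubLmodule of subm by <:].
End Submodule.

Section Quotient.
Local Open Scope quotient_scope.
Variables (K : pzRingType) (V : lmodType K) (S : submodClosed V).

Definition submod_zpred : {pred V} := S.
Fact submod_zpred_closed : zmod_closed submod_zpred.
Proof. exact/GRing.submod_closedB/submodClosedP. Qed.
HB.instance Definition _ := GRing.isZmodClosed.Build V submod_zpred submod_zpred_closed.

(* The quotient group of MathComp, endowed with the induced scaling. *)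
Definition quotm : Type := Quotient.quot submod_zpred.
HB.instance Definition _ := EqQuotient.on quotm.
HB.instance Definition _ := GRing.Zmodule.on quotm.

Definition quotm_pi (x : V) : quotm := \pi_(Quotient.quot submod_zpred) x.

Lemma quotm_eq (x y : V) : quotm_pi x = quotm_pi y <-> x - y \in S.
Proof.
rewrite -[_ \in S]/(x - y \in submod_zpred) Quotient.idealrBE.
by split => [/eqP|/eqP].
Qed.

Lemma quotm_surj (q : quotm) : exists x, q = quotm_pi x.
Proof. by exists (repr q); rewrite /quotm_pi reprK. Qed.

Fact quotm_piD : {morph quotm_pi : x y / x + y}. Proof. exact: pi_addr. Qed.

Definition quotm_scale (c : K) (q : quotm) : quotm := quotm_pi (c *: repr q).

Fact quotm_piZ c x : quotm_scale c (quotm_pi x) = quotm_pi (c *: x).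
Proof.
apply/quotm_eq; rewrite -scalerBr rpredZ //.
by apply/quotm_eq; rewrite /quotm_pi reprK.
Qed.

Fact quotm_scaleA c d q : quotm_scale c (quotm_scale d q) = quotm_scale (c * d) q.
Proof. by case: (quotm_surj q) => x ->; rewrite !quotm_piZ scalerA. Qed.
Fact quotm_scale1 : left_id 1 quotm_scale.
Proof. by move=> q; case: (quotm_surj q) => x ->; rewrite quotm_piZ scale1r. Qed.
Fact quotm_scaleDr : right_distributive quotm_scale +%R.
Proof.
move=> c q r; case: (quotm_surj q) => x ->; case: (quotm_surj r) => y ->.
by rewrite -quotm_piD !quotm_piZ scalerDr quotm_piD.
Qed.
Fact quotm_scaleDl q : {morph quotm_scale^~ q : c d / c + d}.
Proof.
by move=> c d; case: (quotm_surj q) => x ->; rewrite !quotm_piZ scalerDl quotm_piD.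
Qed.
HB.instance Definition _ := GRing.Zmodule_isLmodule.Build K quotm
  quotm_scaleA quotm_scale1 quotm_scaleDr quotm_scaleDl.

Fact quotm_pi_linear : linear quotm_pi.
Proof. by move=> c x y; rewrite quotm_piD -quotm_piZ. Qed.
HB.instance Definition _ := GRing.isLinear.Build K V quotm _ quotm_pi quotm_pi_linear.

Section Descent.
Variables (W : lmodType K) (f : {linear V -> W}).
Hypothesis f0 : forall x, x \in S -> f x = 0.
Definition quotm_lift of (forall x, x \in S -> f x = 0) :=
  fun q : quotm => f (repr q).
Lemma quotm_liftE x : quotm_lift f0 (quotm_pi x) = f x.
Proof.
apply/eqP; rewrite -subr_eq0 -linearB f0 //.
by apply/quotm_eq; rewrite /quotm_pi reprK.
Qed.
Fact quotm_lift_linear : linear (quotm_lift f0).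
Proof.
move=> c q r; case: (quotm_surj q) => x ->; case: (quotm_surj r) => y ->.
by rewrite -linearP !quotm_liftE linearP.
Qed.
HB.instance Definition _ :=
  GRing.isLinear.Build K quotm W _ (quotm_lift f0) quotm_lift_linear.
End Descent.
End Quotient.

Section Restriction.
Variables (K : pzRingType) (V W : lmodType K).
Variables (S : submodClosed V) (T : submodClosed W) (f : {linear V -> W}).
Hypothesis fST : forall x, x \in S -> f x \in T.
Definition subm_map (x : subm S) : subm T := Subm (fST (valP x)).
Fact subm_map_linear : linear subm_map.
Proof. by move=> c x y; apply/val_inj; rewrite /= linearP. Qed.
HB.instance Definition _ :=
  GRing.isLinear.Build K (subm S) (subm T) _ subm_map subm_map_linear.

Fact quotm_map_subproof x : x \in S -> (@quotm_pi K W T \o f) x = 0.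
Proof.
by move=> /fST Tfx; rewrite /= -(linear0 (@quotm_pi K W T)); apply/quotm_eq; rewrite subr0.
Qed.
Definition quotm_map : {linear quotm S -> quotm T} := quotm_lift quotm_map_subproof.
Lemma quotm_mapE x : quotm_map (quotm_pi S x) = quotm_pi T (f x).
Proof. exact: quotm_liftE. Qed.
End Restriction.

Record chain (K : pzRingType) := Chain {
  cob :> nat -> lmodType K;
  cdiff : forall n, {linear cob n.+1 -> cob n};
  cdiffK : forall n (x : cob n.+2), cdiff n (cdiff n.+1 x) = 0 }.
Arguments cdiff {K} c {n}.

Record chain_map (K : pzRingType) (C C' : chain K) := ChainMap {
  cmap :> forall n, {linear C n -> C' n};
  cmap_diff : forall n (x : C n.+1), cmap n (cdiff C x) = cdiff C' (cmap n.+1 x) }.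

Definition chain_homotopic (K : pzRingType) (C C' : chain K) (f g : chain_map C C') : Prop :=
  exists h : forall n, {linear C n -> C' n.+1},
    (forall x : C 0, f 0 x - g 0 x = cdiff C' (h 0 x)) /\
    (forall n (x : C n.+1),
       f n.+1 x - g n.+1 x = cdiff C' (h n.+1 x) + h n (cdiff C x)).

Section Subcomplex.
Variables (K : pzRingType) (C : chain K) (S : forall n, submodClosed (C n)).
Hypothesis S_diff : forall n (x : C n.+1), x \in S n.+1 -> cdiff C x \in S n.

Definition sub_diff n : {linear subm (S n.+1) -> subm (S n)} :=
  subm_map (@S_diff n).
Fact sub_diffK n x : sub_diff n (sub_diff n.+1 x) = 0.
Proof. by apply/val_inj; rewrite /= cdiffK. Qed.
Definition subchain : chain K := Chain sub_diffK.

Definition quot_diff n : {linear quotm (S n.+1) -> quotm (S n)} :=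
  quotm_map (@S_diff n).
Fact quot_diffK n x : quot_diff n (quot_diff n.+1 x) = 0.
Proof. by case: (quotm_surj x) => y ->; rewrite /quot_diff !quotm_mapE cdiffK linear0. Qed.
Definition quotchain : chain K := Chain quot_diffK.
Lemma quot_diffE n (x : C n.+1) :
  cdiff quotchain (quotm_pi (S n.+1) x) = quotm_pi (S n) (cdiff C x).
Proof. exact: quotm_mapE. Qed.
End Subcomplex.

Section SubcomplexMap.
Variables (K : pzRingType) (C C' : chain K) (f : chain_map C C').
Variables (S : forall n, submodClosed (C n)) (S' : forall n, submodClosed (C' n)).
Hypothesis S_diff : forall n (x : C n.+1), x \in S n.+1 -> cdiff C x \in S n.
Hypothesis S'_diff : forall n (x : C' n.+1), x \in S' n.+1 -> cdiff C' x \in S' n.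
Hypothesis fS : forall n x, x \in S n -> f n x \in S' n.

Fact subchain_map_diff n (x : subchain S_diff n.+1) :
  subm_map (@fS n) (cdiff (subchain S_diff) x) =
  cdiff (subchain S'_diff) (subm_map (@fS n.+1) x).
Proof. by apply/val_inj; rewrite /= cmap_diff. Qed.
Definition subchain_map : chain_map (subchain S_diff) (subchain S'_diff) :=
  @ChainMap K (subchain S_diff) (subchain S'_diff)
    (fun n => subm_map (@fS n)) subchain_map_diff.

Fact quotchain_map_diff n (x : quotchain S_diff n.+1) :
  quotm_map (@fS n) (cdiff (quotchain S_diff) x) =
  cdiff (quotchain S'_diff) (quotm_map (@fS n.+1) x).
Proof.
case: (quotm_surj x) => y ->.
have -> := quot_diffE S_diff y.
have -> := quotm_mapE (@fS n) (cdiff C y).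
have -> := quotm_mapE (@fS n.+1) y.
by have -> := quot_diffE S'_diff (f n.+1 y); rewrite cmap_diff.
Qed.
Definition quotchain_map : chain_map (quotchain S_diff) (quotchain S'_diff) :=
  @ChainMap K (quotchain S_diff) (quotchain S'_diff)
    (fun n => quotm_map (@fS n)) quotchain_map_diff.
End SubcomplexMap.

Section OmegaPsi.
Variables (K : pzRingType) (C : chain K) (D : forall n, submodClosed (C n)).

(* In degree 0, the condition [cdiff x \in D (-1)] is void. *)
Definition omega_sub n : {pred C n} :=
  match n return {pred C n} with
  | 0 => [pred x | x \in D 0]
  | m.+1 => [pred x | (x \in D m.+1) && (cdiff C x \in D m)]
  end.
Arguments omega_sub n _ : clear implicits.
Fact omega_sub_closed n : submod_closed (omega_sub n).
Proof.
case: n => [|n]; first by split=> [|c x y]; rewrite !inE ?rpred0 // => xD yD; rewrite rpredD ?rpredZ.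
split; first by rewrite !inE linear0 !rpred0.
move=> c x y; rewrite !inE => /andP[xD dxD] /andP[yD dyD].
by rewrite linearP !rpredD ?rpredZ.
Qed.
HB.instance Definition _ n :=
  GRing.isSubmodClosed.Build K (C n) (omega_sub n) (omega_sub_closed n).
Fact omega_sub_diff n (x : C n.+1) : x \in omega_sub n.+1 -> cdiff C x \in omega_sub n.
Proof.
by rewrite inE => /andP[_ dx]; case: n x dx => [|n] x dx; rewrite inE // dx cdiffK rpred0.
Qed.
Definition omega : chain K := @subchain K C omega_sub omega_sub_diff.

Definition omega'_sub n : {pred C n} :=
  [pred x | `[< exists y z, [/\ y \in D n, z \in D n.+1 & x = y + cdiff C z] >]].
Arguments omega'_sub n _ : clear implicits.
Lemma omega'_subP n (x : C n) :
  reflect (exists y z, [/\ y \in D n, z \in D n.+1 & x = y + cdiff C z])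
    (x \in omega'_sub n).
Proof. exact: asboolP. Qed.
Fact omega'_sub_closed n : submod_closed (omega'_sub n).
Proof.
split; first by apply/omega'_subP; exists 0, 0; rewrite !rpred0 linear0 addr0.
move=> c _ _ /omega'_subP[y [z [yD zD ->]]] /omega'_subP[y' [z' [yD' zD' ->]]].
apply/omega'_subP; exists (c *: y + y'), (c *: z + z'); split.
- by rewrite rpredD ?rpredZ.
- by rewrite rpredD ?rpredZ.
by rewrite linearP scalerDr addrACA.
Qed.
HB.instance Definition _ n :=
  GRing.isSubmodClosed.Build K (C n) (omega'_sub n) (omega'_sub_closed n).
Fact omega'_sub_diff n (x : C n.+1) : x \in omega'_sub n.+1 -> cdiff C x \in omega'_sub n.
Proof.
move=> /omega'_subP[y [z [yD zD ->]]]; apply/omega'_subP; exists 0, y.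
by rewrite rpred0 linearD cdiffK addr0 add0r.
Qed.
Definition psi : chain K := @quotchain K C omega'_sub omega'_sub_diff.
End OmegaPsi.
Arguments omega_sub {K C} D n _.
Arguments omega'_sub {K C} D n _.

Section OmegaPsiMap.
Variables (K : pzRingType) (C C' : chain K) (f : chain_map C C').
Variables (D : forall n, submodClosed (C n)) (D' : forall n, submodClosed (C' n)).
Hypothesis fD : forall n x, x \in D n -> f n x \in D' n.

Fact omega_map_sub n (x : C n) : x \in omega_sub D n -> f n x \in omega_sub D' n.
Proof.
case: n x => [|n] x; rewrite !inE; first exact: fD.
by move=> /andP[/fD -> /fD]; rewrite cmap_diff.
Qed.
Definition omega_map : chain_map (omega D) (omega D') :=
  subchain_map _ _ omega_map_sub.

Fact psi_map_sub n (x : C n) : x \in omega'_sub D n -> f n x \in omega'_sub D' n.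
Proof.
move=> /omega'_subP[y [z [/fD yD /fD zD ->]]]; apply/omega'_subP.
by exists (f n y), (f n.+1 z); rewrite linearD cmap_diff.
Qed.
Definition psi_map : chain_map (psi D) (psi D') :=
  quotchain_map _ _ psi_map_sub.
End OmegaPsiMap.

Record smod (K : pzRingType) := SMod {
  aob :> nat -> lmodType K;
  aact : forall m n, mono m n -> {linear aob n -> aob m};
  aact_id : forall n (x : aob n), aact (midm n) x = x;
  aact_comp : forall m n p (g : mono n p) (f : mono m n) (x : aob p),
    aact (mcomp g f) x = aact f (aact g x) }.
Arguments aact {K} s {m n} _.

Record smod_map (K : pzRingType) (A A' : smod K) := SModMap {
  amap :> forall n, {linear A n -> A' n};
  amap_act : forall m n (u : mono m n) (x : A n),
    amap m (aact A u x) = aact A' u (amap n x) }.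

Definition aface (K : pzRingType) (A : smod K) n (i : 'I_n.+2) : {linear A n.+1 -> A n} :=
  aact A (coface i).
Definition adegen (K : pzRingType) (A : smod K) n (i : 'I_n.+1) : {linear A n -> A n.+1} :=
  aact A (codegen i).

Lemma coface_coface n (i j : 'I_n.+2) : (i <= j)%N ->
  mcomp (coface (lift ord0 j)) (coface i) =
  mcomp (coface (widen_ord (leqnSn _) i)) (coface j).
Proof.
by move=> ij; apply: monoP => t; rewrite !mcompE !cofaceE /= /bump; lia.
Qed.

Lemma coface_factor m n (g : mono m n.+1) (i : 'I_n.+2) :
  (forall t, g t != i) -> exists w : mono m n, g = mcomp (coface i) w.
Proof.
move=> gi; have w_lt (t : 'I_m.+1) : (unbump i (g t) < n.+1)%N.
  by have := gi t; rewrite -val_eqE /= /unbump; have := ltn_ord (g t); have := ltn_ord i; lia.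
have w_le (s t : 'I_m.+1) : (s <= t)%N -> (Ordinal (w_lt s) <= Ordinal (w_lt t))%N.
  by move=> /(mono_le g); rewrite /= /unbump; move: (nat_of_ord (g s)) (nat_of_ord (g t)) => a b; lia.
exists (mkmono w_le); apply: monoP => t; rewrite mcompE cofaceE mkmonoE /= /bump /unbump.
by have := gi t; rewrite -val_eqE /=; move: (nat_of_ord (g t)) => a; lia.
Qed.

Lemma codegen_factor m n (g : mono m.+1 n) (j : 'I_m.+1) :
  (forall s t : 'I_m.+2, s = j :> nat -> t = j.+1 :> nat -> g s = g t) ->
  exists w : mono m n, g = mcomp w (codegen j).
Proof.
move=> gj; exists (mcomp g (coface (lift ord0 j))); apply: monoP => t.
rewrite !mcompE; set s := (X in _ = nat_of_ord (g X)).
have sE : s = bump j.+1 (unbump j t) :> nat by rewrite cofaceE codegenE.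
have [e|ne] := eqVneq (nat_of_ord t) j.+1.
  congr nat_of_ord; symmetry; apply: gj => //.
  by rewrite sE e /bump /unbump; lia.
congr (nat_of_ord (g _)); apply/val_inj; rewrite /= sE /bump /unbump.
by move: ne; move: (nat_of_ord t) => a; lia.
Qed.

Section Moore.
Variables (K : pzRingType) (A : smod K).

Definition unnorm_diff_fun n (x : A n.+1) : A n :=
  \sum_(i < n.+2) (-1) ^+ i *: aface A i x.
Fact unnorm_diff_linear n : linear (@unnorm_diff_fun n).
Proof.
move=> c x y; rewrite /unnorm_diff_fun scaler_sumr -big_split /=.
by apply: eq_bigr => i _; rewrite linearP scalerDr !scalerA commr_sign.
Qed.
HB.instance Definition _ n :=
  GRing.isLinear.Build K (A n.+1) (A n) _ (@unnorm_diff_fun n) (@unnorm_diff_linear n).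
Definition unnorm_diff n : {linear A n.+1 -> A n} := @unnorm_diff_fun n.

Lemma aface_aface n (i j : 'I_n.+2) (x : A n.+2) : (i <= j)%N ->
  aface A i (aface A (lift ord0 j) x) = aface A j (aface A (widen_ord (leqnSn _) i) x).
Proof. by move=> ij; rewrite /aface -!aact_comp coface_coface. Qed.

Fact unnorm_diffK n (x : A n.+2) : unnorm_diff n (unnorm_diff n.+1 x) = 0.
Proof.
pose G (i : 'I_n.+2) (j : 'I_n.+3) := (-1) ^+ (i + j) *: aface A i (aface A j x).
have -> : unnorm_diff n (unnorm_diff n.+1 x) = \sum_i \sum_j G i j.
  apply: eq_bigr => i _; rewrite linear_sum scaler_sumr; apply: eq_bigr => j _.
  by rewrite linearZ /= scalerA -exprD.
have E i : \sum_j G i j =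
    \sum_(j < n.+2 | (j <= i)%N) G i (widen_ord (leqnSn _) j)
    + \sum_(j < n.+2 | (i <= j)%N) G i (lift ord0 j).
  rewrite (bigID (fun j : 'I_n.+3 => (j <= i)%N)) /=; congr (_ + _).
    rewrite big_mkcond big_ord_recr /= leqNgt ltn_ord addr0.
    by rewrite -big_mkcond.
  rewrite big_mkcond big_ord_recl /= add0r.
  by rewrite -big_mkcond; apply: eq_bigl => j; rewrite /bump /= add1n -ltnNge ltnS.
rewrite (eq_bigr _ (fun i _ => E i)) big_split /=.
rewrite [X in _ + X](exchange_big_dep predT) //= -big_split big1 //= => i _.
rewrite -big_split big1 //= => j ji; rewrite /G /= aface_aface // /bump add1n.
by rewrite addnS exprS mulN1r scaleNr [(j + i)%N]addnC subrr.
Qed.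
Definition unnorm : chain K := Chain unnorm_diffK.

Definition moore_sub n : {pred A n} :=
  match n return {pred A n} with
  | 0 => predT
  | m.+1 => [pred x | [forall i : 'I_m.+2, (i != ord0) ==> (aface A i x == 0)]]
  end.
Arguments moore_sub n _ : clear implicits.
Lemma moore_subP n (x : A n.+1) :
  reflect (forall i : 'I_n.+2, i != ord0 -> aface A i x = 0) (x \in moore_sub n.+1).
Proof.
apply: (iffP forallP) => H i; first by move=> i0; have /implyP/(_ i0)/eqP := H i.
by apply/implyP => i0; rewrite H.
Qed.
Fact moore_sub_closed n : submod_closed (moore_sub n).
Proof.
case: n => [//|n]; split; first by apply/moore_subP => i _; rewrite linear0.
move=> c x y /moore_subP xN /moore_subP yN; apply/moore_subP => i i0.
by rewrite linearP xN // yN // scaler0 addr0.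
Qed.
HB.instance Definition _ n :=
  GRing.isSubmodClosed.Build K (A n) (moore_sub n) (moore_sub_closed n).

Lemma unnorm_diff_moore n (x : A n.+1) : x \in moore_sub n.+1 ->
  unnorm_diff n x = aface A ord0 x.
Proof.
move=> /moore_subP xN; rewrite [LHS]big_ord_recl expr0 scale1r big1 ?addr0 // => i _.
by rewrite xN // scaler0.
Qed.

Fact moore_sub_diff n (x : unnorm n.+1) : x \in moore_sub n.+1 ->
  cdiff unnorm x \in moore_sub n.
Proof.
case: n x => [//|n] x xN; rewrite [cdiff _ _]unnorm_diff_moore //.
apply/moore_subP => i i0; have := @aface_aface n ord0 i x (leq0n _).
rewrite (_ : widen_ord _ _ = ord0); last exact/val_inj.
by move=> <-; move/moore_subP: xN => ->; rewrite ?linear0.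
Qed.
Definition moore : chain K := @subchain K unnorm moore_sub moore_sub_diff.

Definition degen_sub n : {pred A n} :=
  match n return {pred A n} with
  | 0 => [pred x | x == 0]
  | m.+1 => [pred x | `[< exists a : 'I_m.+1 -> A m, x = \sum_i adegen A i (a i) >]]
  end.
Arguments degen_sub n _ : clear implicits.
Lemma degen_subP n (x : A n.+1) :
  reflect (exists a : 'I_n.+1 -> A n, x = \sum_i adegen A i (a i)) (x \in degen_sub n.+1).
Proof. exact: asboolP. Qed.
Fact degen_sub_closed n : submod_closed (degen_sub n).
Proof.
case: n => [|n].
  split=> [|c x y]; rewrite !inE // => /eqP -> /eqP ->.
  by rewrite scaler0 addr0.
split; first by apply/degen_subP; exists (fun=> 0); rewrite big1 // => i _; rewrite linear0.
move=> c _ _ /degen_subP [a ->] /degen_subP [b ->]; apply/degen_subP.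
exists (fun i => c *: a i + b i); rewrite scaler_sumr -big_split /=.
by apply: eq_bigr => i _; rewrite linearP.
Qed.
HB.instance Definition _ n :=
  GRing.isSubmodClosed.Build K (A n) (degen_sub n) (degen_sub_closed n).

Lemma adegen_sub n (i : 'I_n.+1) (x : A n) : adegen A i x \in degen_sub n.+1.
Proof.
apply/degen_subP; exists (fun j => if j == i then x else 0).
rewrite (bigD1 i) //= eqxx big1 ?addr0 // => j /negbTE ->.
by rewrite linear0.
Qed.

Lemma moore_degen_ex n (a : A n) :
  exists2 x, x \in moore_sub n & a - x \in degen_sub n.
Proof.
case: n a => [|n] a; first by exists a => //; rewrite subrr rpred0.
suff H k : (k <= n.+1)%N -> exists2 x,
    (forall i : 'I_n.+2, (n.+1 - k < i)%N -> aface A i x = 0) & a - x \in degen_sub n.+1.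
  have [x xN xD] := H _ (leqnn _); exists x => //.
  by apply/moore_subP => i i0; apply: xN; rewrite subnn lt0n.
elim: k => [_|k IH k_lt].
  by exists a => [i|]; rewrite ?subrr ?rpred0 // subn0 ltnNge -ltnS ltn_ord.
have [x xN xD] := IH (ltnW k_lt).
have j_lt : (n - k < n.+1)%N by lia.
pose j := Ordinal j_lt; pose j1 : 'I_n.+2 := lift ord0 j.
exists (x - adegen A j (aface A j1 x)); last first.
  by rewrite opprB addrCA addrC rpredD ?adegen_sub.
move=> i i_gt; rewrite linearB /=.
have [e|ne] := eqVneq i j1.
  apply/eqP; rewrite subr_eq0 e /aface /adegen -!aact_comp; apply/eqP.
  congr (aact A _ x); apply: monoP => t.
  rewrite !mcompE !(cofaceE, codegenE) /= /bump /unbump.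
  by move: (nat_of_ord t) => u; lia.
have i_gt1 : (n.+1 - k < i)%N.
  by move: ne; rewrite -val_eqE /= /bump; move: i_gt; move: (nat_of_ord i) => u; lia.
rewrite (xN i) // /aface /adegen -!aact_comp.
case: (@coface_factor n n (mcomp (mcomp (coface j1) (codegen j)) (coface i)) i).
  move=> t; apply/eqP => /(congr1 (@nat_of_ord _)).
  rewrite !mcompE !(cofaceE, codegenE) /= /bump /unbump.
  by move: i_gt1; move: (nat_of_ord t) (nat_of_ord i) => u v; lia.
move=> w ->; rewrite aact_comp -[aact A (coface i) x]/(aface A i x) xN //.
by rewrite linear0 subrr.
Qed.

Lemma moore_degen_0 n (x : A n) : x \in moore_sub n -> x \in degen_sub n -> x = 0.
Proof.
case: n x => [|n] x; first by rewrite inE => _ /eqP.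
move=> /moore_subP xN /degen_subP [a xE].
suff H k : (k <= n.+1)%N -> exists a : 'I_n.+1 -> A n,
    x = \sum_(i < n.+1 | (i < n.+1 - k)%N) adegen A i (a i).
  by have [b ->] := H _ (leqnn _); rewrite subnn big_pred0.
elim: k => [_|k IH k_lt].
  by exists a; rewrite subn0 xE; apply: eq_bigl => i; rewrite ltn_ord.
have [b {a}xE] := IH (ltnW k_lt).
have j_lt : (n - k < n.+1)%N by lia.
pose j := Ordinal j_lt; pose j1 : 'I_n.+2 := lift ord0 j.
have jE : (j < n.+1 - k)%N by rewrite /=; lia.
have sd0 : adegen A j (aface A j1 x) = 0 by rewrite xN // linear0.
have lt_j (i : 'I_n.+1) : ((i < n.+1 - k)%N && (i != j)) = (i < n.+1 - k.+1)%N.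
  by rewrite -val_eqE /=; move: (nat_of_ord i) => u; lia.
have W (i : 'I_n.+1) : exists c, (i < n.+1 - k.+1)%N ->
    adegen A j (aface A j1 (adegen A i (b i))) = adegen A i c.
  case: ltnP => [i_lt|_]; last by exists 0.
  rewrite /aface /adegen -!aact_comp.
  case: (@codegen_factor n n (mcomp (codegen i) (mcomp (coface j1) (codegen j))) i).
    move=> s t sE tE; apply: ord_inj.
    rewrite !mcompE !(cofaceE, codegenE) sE tE /= /bump /unbump.
    by move: i_lt; move: (nat_of_ord i) => u; lia.
  by move=> w ->; exists (aact A w (b i)); rewrite -aact_comp.
have [c cE] := choice W.
exists (fun i => b i - c i).
have -> : x = x - adegen A j (aface A j1 x) by rewrite sd0 subr0.
rewrite xE !linear_sum -big_split (bigD1 j) //=.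
have -> : adegen A j (aface A j1 (adegen A j (b j))) = adegen A j (b j).
  rewrite /aface /adegen -!aact_comp; congr (aact A _ (b j)).
  apply: monoP => t; rewrite !mcompE !(cofaceE, codegenE) /= /bump /unbump.
  by move: (nat_of_ord t) => u; lia.
rewrite subrr add0r (eq_bigl _ _ lt_j); apply: eq_bigr => i i_lt.
by rewrite cE // linearB.
Qed.

(* The projection onto the Moore complex along the degenerate submodules:
   by [rho_uniq], [rho a] is the only element of the Moore complex that
   differs from [a] by a degenerate element. *)
Definition rho n (a : A n) : moore n :=
  xget 0 [set x : moore n | a - val x \in degen_sub n].

Lemma rhoP n (a : A n) : a - val (rho a) \in degen_sub n.
Proof.
have [x xN xD] := moore_degen_ex a.
by apply: (@xgetPex _ 0 [set x : moore n | a - val x \in degen_sub n]); exists (Subm xN).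
Qed.

Lemma rho_uniq n (a : A n) (x : moore n) : a - val x \in degen_sub n -> rho a = x.
Proof.
move=> xD; apply/val_inj/eqP; rewrite -subr_eq0; apply/eqP/moore_degen_0.
  by apply: rpredB; exact: valP.
have -> : val (rho a) - val x = (a - val x) - (a - val (rho a)).
  by rewrite opprB [RHS]addrC addrA subrK.
by apply: rpredB => //; exact: rhoP.
Qed.

Fact rho_linear n : linear (@rho n).
Proof.
move=> c a b; apply: rho_uniq; rewrite /= opprD addrACA -scalerBr.
by rewrite rpredD ?rpredZ ?rhoP.
Qed.
HB.instance Definition _ n :=
  GRing.isLinear.Build K (A n) (moore n) _ (@rho n) (@rho_linear n).

Lemma rho_moore n (x : moore n) : rho (val x) = x.
Proof. by apply: rho_uniq; rewrite subrr rpred0. Qed.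

Lemma rho_degen n (a : A n) : a \in degen_sub n -> rho a = 0.
Proof. by move=> aD; apply: rho_uniq; rewrite subr0. Qed.
End Moore.
Arguments moore_sub {K} A n _.
Arguments degen_sub {K} A n _.

Section MooreMap.
Variables (K : pzRingType) (A A' : smod K) (f : smod_map A A').

Fact unnorm_map_diff n (x : unnorm A n.+1) :
  f n (cdiff (unnorm A) x) = cdiff (unnorm A') (f n.+1 x).
Proof.
rewrite [LHS]linear_sum; apply: eq_bigr => i _.
by rewrite linearZ /= amap_act.
Qed.
Definition unnorm_map : chain_map (unnorm A) (unnorm A') :=
  @ChainMap K (unnorm A) (unnorm A') (fun n => f n) unnorm_map_diff.

Fact moore_map_sub n (x : unnorm A n) :
  x \in moore_sub A n -> unnorm_map n x \in moore_sub A' n.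
Proof.
case: n x => [//|n] x /moore_subP xN; apply/moore_subP => i i0.
by rewrite /= /aface -amap_act -/(aface A i) xN // linear0.
Qed.
Definition moore_map : chain_map (moore A) (moore A') :=
  subchain_map _ _ moore_map_sub.

Lemma amap_degen n (x : A n) : x \in degen_sub A n -> f n x \in degen_sub A' n.
Proof.
case: n x => [|n] x; first by rewrite !inE => /eqP ->; rewrite linear0.
move=> /degen_subP[a ->]; apply/degen_subP; exists (fun i => f n (a i)).
by rewrite linear_sum; apply: eq_bigr => i _; rewrite /= amap_act.
Qed.

Lemma moore_map_rho n (a : A n) : moore_map n (rho a) = rho (f n a).
Proof.
by symmetry; apply: rho_uniq; rewrite /= -linearB amap_degen // rhoP.
Qed.
End MooreMap.

Section RhoImage.
Variables (K : pzRingType) (A : smod K) (B : forall n, submodClosed (A n)).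
Definition rho_sub n : {pred moore A n} :=
  [pred x | `[< exists2 b, b \in B n & x = rho b >]].
Arguments rho_sub n _ : clear implicits.
Lemma rho_subP n (x : moore A n) :
  reflect (exists2 b, b \in B n & x = rho b) (x \in rho_sub n).
Proof. exact: asboolP. Qed.
Fact rho_sub_closed n : submod_closed (rho_sub n).
Proof.
split; first by apply/rho_subP; exists 0; rewrite ?rpred0 ?linear0.
move=> c _ _ /rho_subP[a aB ->] /rho_subP[b bB ->]; apply/rho_subP.
by exists (c *: a + b); [rewrite rpredD ?rpredZ | rewrite linearP].
Qed.
HB.instance Definition _ n :=
  GRing.isSubmodClosed.Build K (moore A n) (rho_sub n) (rho_sub_closed n).
End RhoImage.
Arguments rho_sub {K A} B n _.

Section FreeSMod.
Variable K : pzRingType.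

Section Object.
Variable X : sset.
Fact free_smod_id n (a : freemod K (X n)) : free_map K (sact (midm n)) a = a.
Proof.
apply: (@linear_freeP K _ _ (free_map K (sact (midm n))) idfun) => x.
by rewrite free_map_basis sact_id.
Qed.
Fact free_smod_comp m n p (g : mono n p) (f : mono m n) (a : freemod K (X p)) :
  free_map K (sact (mcomp g f)) a = free_map K (sact f) (free_map K (sact g) a).
Proof.
apply: (@linear_freeP K _ _ (free_map K (sact (mcomp g f)))
  (free_map K (sact f) \o free_map K (sact g))) => x.
by rewrite /= !free_map_basis sact_comp.
Qed.
Definition free_smod : smod K :=
  @SMod K (fun n => freemod K (X n)) (fun m n u => free_map K (sact u))
    free_smod_id free_smod_comp.
End Object.

Section Map.
Variables (X X' : sset) (f : smap X X').
Fact free_smod_map_act m n (u : mono m n) (a : free_smod X n) :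
  free_map K (@f m) (aact (free_smod X) u a) =
  aact (free_smod X') u (free_map K (@f n) a).
Proof.
apply: (@linear_freeP K _ _ (free_map K (@f m) \o free_map K (sact u))
  (free_map K (sact u) \o free_map K (@f n))) => x.
by rewrite /= !free_map_basis smap_act.
Qed.
Definition free_smod_map : smod_map (free_smod X) (free_smod X') :=
  @SModMap K (free_smod X) (free_smod X') (fun n => free_map K (@f n))
    free_smod_map_act.
End Map.
End FreeSMod.

Section PathPairChains.
Variable K : comPzRingType.

Definition pp_moore (S : path_pair) : chain K := moore (free_smod K S).

Definition pp_bar (S : path_pair) n : submodClosed (pp_moore S n) :=
  rho_sub (A := free_smod K S) (fun n => free_sub K (@pp_sub S n)) n.

Definition Omega (S : path_pair) : chain K := omega (pp_bar S).
Definition Psi (S : path_pair) : chain K := psi (pp_bar S).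

Section Map.
Variables (S S' : path_pair) (f : pp_map S S').
Definition pp_moore_map : chain_map (pp_moore S) (pp_moore S') :=
  moore_map (free_smod_map K f).
Fact pp_moore_map_bar n (x : pp_moore S n) :
  x \in pp_bar S n -> pp_moore_map n x \in pp_bar S' n.
Proof.
move=> /rho_subP[b bY ->]; apply/rho_subP; exists (free_smod_map K f n b).
  by apply: free_map_sub bY => y; exact: pp_mapP.
exact: moore_map_rho.
Qed.
Definition Omega_map : chain_map (Omega S) (Omega S') := omega_map pp_moore_map_bar.
Definition Psi_map : chain_map (Psi S) (Psi S') := psi_map pp_moore_map_bar.
End Map.
End PathPairChains.

(* Main.v *)
(* The prisms [(s_j y, tau_j)], with [tau_j : [n+1] -> [1]] the step function
   jumping after [j], belong to the diamond of [Y] with the 1-simplices: they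
   are the (n, 1)-shuffles.  So the classical prism operator of a homotopy [H]
   carries K[Y] into K[Y'].  It also preserves degenerate chains, hence descends
   along rho to a chain homotopy of Moore complexes which respects the graded
   submodules; such a homotopy restricts to omega and descends to psi. *)
Require Import Defs.
From HB Require Import structures.
From mathcomp Require Import all_boot all_algebra.
From mathcomp Require Import zify.

Set Implicit Arguments.
Unset Strict Implicit.
Unset Printing Implicit Defensive.

Import GRing.Theory.
Local Open Scope ring_scope.

(** [chain_homotopic] hides the operator behind an existential. Naming it makes it possible to
    require, in addition, that it preserve given submodules. *)
Definition is_chain_homotopy (K : pzRingType) (C C' : chain K) (f g : chain_map C C')
    (h : forall n, {linear C n -> C' n.+1}) : Prop :=
  (forall x : C 0%N, f 0%N x - g 0%N x = cdiff C' (h 0%N x)) /\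
  (forall n (x : C n.+1),
     f n.+1 x - g n.+1 x = cdiff C' (h n.+1 x) + h n (cdiff C x)).

(** * Chain homotopy as an equivalence relation *)

Section ChainHomotopicEquiv.
Variables (K : pzRingType) (C C' : chain K).
Implicit Types f g : chain_map C C'.

Lemma chain_homotopic_refl f : chain_homotopic f f.
Proof.
exists (fun n => \0 : {linear C n -> C' n.+1}).
by split=> [x|n x]; rewrite /= subrr linear0 ?addr0.
Qed.

Lemma chain_homotopic_sym f g : chain_homotopic f g -> chain_homotopic g f.
Proof.
case=> h [h0 hS]; exists (fun n => \- h n : {linear C n -> C' n.+1}).
by split=> [x|n x] /=; rewrite linearN -opprB ?h0 ?hS ?opprD.
Qed.

Lemma chain_homotopic_trans g f k :
  chain_homotopic f g -> chain_homotopic g k -> chain_homotopic f k.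
Proof.
case=> h [h0 hS] [l [l0 lS]].
exists (fun n => h n \+ l n : {linear C n -> C' n.+1}).
split=> [x|n x] /=; rewrite linearD -(subrKA (g _ x)).
  by rewrite h0 l0.
by rewrite hS lS addrACA.
Qed.

End ChainHomotopicEquiv.

(* [submodClosed] is built on semimodules and does not inherit [rpredN]. *)
Lemma submodClosedN (K : pzRingType) (V : lmodType K) (D : submodClosed V) x :
  x \in D -> - x \in D.
Proof. by move=> xD; rewrite -scaleN1r rpredZ. Qed.

Lemma submodClosedB (K : pzRingType) (V : lmodType K) (D : submodClosed V) x y :
  x \in D -> y \in D -> x - y \in D.
Proof. by move=> xD yD; rewrite rpredD ?submodClosedN. Qed.

(** * Homotopies compatible with graded submodules, on [omega] and [psi] *)

Section OmegaPsiHomotopy.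
Variables (K : pzRingType) (C C' : chain K) (f g : chain_map C C').
Variables (D : forall n, submodClosed (C n)) (D' : forall n, submodClosed (C' n)).
Hypothesis fD : forall n x, x \in D n -> f n x \in D' n.
Hypothesis gD : forall n x, x \in D n -> g n x \in D' n.
Variable h : forall n, {linear C n -> C' n.+1}.
Hypothesis fgh : is_chain_homotopy f g h.
Hypothesis hD : forall n x, x \in D n -> h n x \in D' n.+1.

(** The homotopy relation, solved for the boundary of [h x], gives [f x - g x - h (d x)]. Each term
    lies in [D'] because both [x] and [d x] lie in [D]; in degree 0 the last term is absent. *)
Lemma homotopy_omega_sub n (x : C n) :
  x \in omega_sub D n -> h n x \in omega_sub D' n.+1.
Proof.
case: fgh => h0 hS; case: n x => [|n] x; rewrite !inE.
  by move=> xD; rewrite hD //= -h0 submodClosedB ?fD ?gD.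
move=> /andP[xD dxD]; rewrite hD //=.
have -> : cdiff C' (h n.+1 x) = f n.+1 x - g n.+1 x - h n (cdiff C x).
  by rewrite hS addrK.
by rewrite !submodClosedB ?fD ?gD ?hD.
Qed.

Lemma homotopy_omega'_sub n (x : C n) :
  x \in omega'_sub D n -> h n x \in omega'_sub D' n.+1.
Proof.
case: fgh => _ hS /omega'_subP[y [z [yD zD ->]]]; apply/omega'_subP.
(* Applying the homotopy relation to [z] turns [h (d z)] into [f z - g z - d (h z)]; the last term
   is the boundary of [- h z]. *)
exists (h n y + (f n.+1 z - g n.+1 z)), (- h n.+1 z); split.
- by rewrite rpredD ?submodClosedB ?fD ?gD ?hD.
- exact/submodClosedN/hD.
by rewrite hS !linearD linearN -addrA [X in _ = _ + X]addrAC subrr add0r.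
Qed.

Lemma omega_map_homotopic : chain_homotopic (omega_map fD) (omega_map gD).
Proof.
case: fgh => h0 hS.
exists (fun n => subm_map (@homotopy_omega_sub n)).
by split=> [x|n x]; apply/val_inj; rewrite /= ?h0 ?hS.
Qed.

Definition psi_homotopy n : {linear psi D n -> psi D' n.+1} :=
  quotm_map (@homotopy_omega'_sub n).

Lemma psi_map_homotopic : chain_homotopic (psi_map fD) (psi_map gD).
Proof.
case: fgh => h0 hS; exists psi_homotopy.
(* All maps on [psi] are computed on representatives. The equations below pull the projections
   outside, which leaves the relation [h0] or [hS] in [C']. *)
pose p n (x : C n) : psi D n := quotm_pi (omega'_sub D n) x.
pose p' n (x : C' n) : psi D' n := quotm_pi (omega'_sub D' n) x.
have fE n x : psi_map fD n (p n x) = p' n (f n x) := quotm_mapE _ _.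
have gE n x : psi_map gD n (p n x) = p' n (g n x) := quotm_mapE _ _.
have hE n x : psi_homotopy n (p n x) = p' n.+1 (h n x) := quotm_mapE _ _.
have dE n x : cdiff (psi D) (p n.+1 x) = p n (cdiff C x) := quot_diffE _ _.
have d'E n x : cdiff (psi D') (p' n.+1 x) = p' n (cdiff C' x) := quot_diffE _ _.
have p'B n x y : p' n x - p' n y = p' n (x - y) by rewrite /p' -linearB.
have p'D n x y : p' n x + p' n y = p' n (x + y) by rewrite /p' -linearD.
split=> [q|n q]; case: (quotm_surj q) => x ->; rewrite -/(p _ x).
  by rewrite fE gE hE d'E p'B h0.
by rewrite fE gE hE d'E dE hE p'B p'D hS.
Qed.
End OmegaPsiHomotopy.

(** * The projection [rho] as a chain map *)

Section RhoChainMap.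
Variables (K : pzRingType) (A : smod K).

(** This is d_i s_j = s_k d_l with k = j - 1 for i < j and k = j for i > j + 1: the underlying
    monotone map identifies k and k + 1, hence factors through [codegen] at k. *)
Lemma aface_adegen_degen n (i : 'I_n.+3) (j : 'I_n.+2) (a : A n.+1) :
  i != j :> nat -> i != j.+1 :> nat ->
  aface A i (adegen A j a) \in degen_sub A n.+1.
Proof.
move=> ij ij1; rewrite /aface /adegen -aact_comp.
have k_lt : (unbump i j < n.+1)%N.
  by move: ij ij1 (ltn_ord i) (ltn_ord j); rewrite /unbump; lia.
have [s t sE tE|w ->] := @codegen_factor n n.+1
    (mcomp (codegen j) (coface i)) (Ordinal k_lt).
  apply: ord_inj; rewrite !mcompE !(cofaceE, codegenE) sE tE /=.
  by move: ij ij1; rewrite /bump /unbump; lia.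
by rewrite aact_comp adegen_sub.
Qed.

Lemma aface_adegen_id n (i : 'I_n.+2) (j : 'I_n.+1) (a : A n) :
  i = j :> nat \/ i = j.+1 :> nat -> aface A i (adegen A j a) = a.
Proof.
move=> ij; rewrite /aface /adegen -aact_comp -[RHS]aact_id; congr (aact A _ a).
apply: monoP => t; rewrite mcompE midmE codegenE cofaceE /bump /unbump.
by case: ij => ->; lia.
Qed.

(** In the boundary of s_j a, the faces j and j + 1 both give a with opposite signs and cancel; all
    the others are degenerate. *)
Lemma unnorm_diff_degen n (x : A n.+1) :
  x \in degen_sub A n.+1 -> unnorm_diff A n x \in degen_sub A n.
Proof.
move=> /degen_subP[a {x}->]; rewrite linear_sum; apply: rpred_sum => j _.
rewrite [unnorm_diff _ _ _]/(unnorm_diff_fun _) /unnorm_diff_fun.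
rewrite (bigD1 (widen_ord (leqnSn _) j)) //= (bigD1 (lift ord0 j)) /=; last first.
  by rewrite -val_eqE /= /bump; lia.
rewrite addrA !aface_adegen_id; [|by right|by left].
rewrite /bump add1n exprS mulN1r scaleNr subrr add0r.
apply: rpred_sum => i /andP[]; rewrite -!val_eqE /= /bump add1n => ij ij1.
(* For n = 0 only the two cancelled faces exist, so nothing remains to be placed in the zero module
   [degen_sub A 0]. *)
apply: rpredZ; case: n a j i ij ij1 => [|n] a j i ij ij1.
  by exfalso; move: ij ij1 (ltn_ord i) (ltn_ord j); lia.
exact: aface_adegen_degen.
Qed.

Lemma rho_unnorm_diff n (a : A n.+1) :
  rho (unnorm_diff A n a) = cdiff (moore A) (rho a).
Proof. by apply: rho_uniq; rewrite -linearB unnorm_diff_degen ?rhoP. Qed.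
End RhoChainMap.

(** * Descent of homotopies to Moore complexes *)

Section MooreHomotopy.
Variables (K : pzRingType) (A A' : smod K) (f g : smod_map A A').
Variable h : forall n, {linear A n -> A' n.+1}.
Hypothesis fgh : is_chain_homotopy (unnorm_map f) (unnorm_map g) h.
Hypothesis h_degen : forall n x, x \in degen_sub A n -> h n x \in degen_sub A' n.+1.

Definition moore_homotopy n : {linear moore A n -> moore A' n.+1} :=
  @rho K A' n.+1 \o h n \o (val : moore A n -> A n).

(** The elements [a] and [rho a] differ by a degenerate one, which [h] keeps degenerate and [rho]
    kills. This gives control of the homotopy on images of submodules under [rho]. *)
Lemma moore_homotopy_rho n (a : A n) : moore_homotopy n (rho a) = rho (h n a).
Proof.
apply/esym/eqP; rewrite /= -subr_eq0 -!linearB; apply/eqP/rho_degen/h_degen.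
exact: rhoP.
Qed.

Lemma moore_homotopyP : is_chain_homotopy (moore_map f) (moore_map g) moore_homotopy.
Proof.
case: fgh => h0 hS; split=> [x|n x].
  (* A Moore element is its own projection, so by naturality the relation is [rho] applied to the
     unnormalized one. *)
  rewrite -{1 2}(rho_moore x) !moore_map_rho -linearB [_ - _]h0.
  exact: rho_unnorm_diff.
rewrite -{1 2}(rho_moore x) !moore_map_rho -linearB [_ - _]hS linearD.
by congr (_ + _); exact: rho_unnorm_diff.
Qed.
End MooreHomotopy.

(** * The prism operator of a one-step homotopy *)

Section Prism.
Variables (K : comPzRingType) (S S' : path_pair).
Variable H : pp_map (box S interval_pp) S'.

Fact step_lt p t : ((p <= t) < 2)%N.
Proof. by case: (p <= t)%N. Qed.
Fact step_le n p (s t : 'I_n.+1) :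
  (s <= t)%N -> (Ordinal (step_lt p s) <= Ordinal (step_lt p t))%N.
Proof. by move=> st /=; lia. Qed.
(** The jump is indexed by the first vertex sent to 1, so the prism of index j uses [p = j.+1];
    [p = 0] and [p = n.+1] give the two constant maps. *)
Definition step n p : mono n 1 := mkmono (@step_le n p).

Lemma stepE n p t : step n p t = (p <= t)%N :> nat.
Proof. by rewrite mkmonoE. Qed.

(** This family is stable under simplicial operators on both sides, so every identity between faces
    and prisms reduces to one between monotone maps. *)
Definition prism_map m n (u : mono m n) (v : mono m 1) :
    {linear free_smod K S n -> free_smod K S' m} :=
  free_map K (fun x : S n => H m (sact u x, v)).

Lemma prism_map_basis m n (u : mono m n) (v : mono m 1) x :
  prism_map u v (fbasis K x) = fbasis K (H m (sact u x, v)).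
Proof. exact: free_map_basis. Qed.

Lemma aact_prism_map k m n (w : mono k m) (u : mono m n) v a :
  aact (free_smod K S') w (prism_map u v a) = prism_map (mcomp u w) (mcomp v w) a.
Proof.
apply: (@linear_freeP K _ _ (aact (free_smod K S') w \o prism_map u v)) => x.
by rewrite /= !prism_map_basis free_map_basis -smap_act sact_comp.
Qed.

Lemma prism_map_aact k m n (w : mono m n) (u : mono k m) v a :
  prism_map u v (aact (free_smod K S) w a) = prism_map (mcomp w u) v a.
Proof.
apply: (@linear_freeP K _ _ (prism_map u v \o aact (free_smod K S) w)) => x.
by rewrite /= prism_map_basis free_map_basis prism_map_basis sact_comp.
Qed.

(** Over a constant 1-simplex the homotopy restricts to an end of the cylinder: value 1 for [e = 0],
    value 0 for [e = 1]. *)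
Lemma prism_map_end (e : 'I_2) n (v : mono n 1) a :
  (forall t, v t = coface e ord0) ->
  prism_map (midm n) v a = free_smod_map K (pp_comp H (interval_incl S e)) n a.
Proof.
move=> vE; apply: (linear_freeP (g := free_smod_map K _ n)) => x.
rewrite prism_map_basis free_map_basis sact_id /=.
congr (fbasis K (H n (x, _))); apply: monoP => t.
by rewrite mcompE vE [pt_simplex n t]ord1.
Qed.

Lemma prism_map_degen m n (u : mono m.+1 n) (v : mono m.+1 1) (k : 'I_m.+1) a :
  (forall s t : 'I_m.+2, s = k :> nat -> t = k.+1 :> nat -> u s = u t /\ v s = v t) ->
  prism_map u v a \in degen_sub (free_smod K S') m.+1.
Proof.
move=> uv.
have [s t sE tE|u' ->] := @codegen_factor _ _ u k; first by case: (uv s t sE tE).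
have [s t sE tE|v' ->] := @codegen_factor _ _ v k; first by case: (uv s t sE tE).
by rewrite -aact_prism_map adegen_sub.
Qed.

Definition prism_fun n (a : free_smod K S n) : free_smod K S' n.+1 :=
  \sum_(j < n.+1) (-1) ^+ j *: prism_map (codegen j) (step n.+1 j.+1) a.
Fact prism_linear n : linear (@prism_fun n).
Proof.
move=> c x y; rewrite /prism_fun scaler_sumr -big_split /=.
by apply: eq_bigr => i _; rewrite linearP scalerDr !scalerA mulrC.
Qed.
HB.instance Definition _ n := GRing.isLinear.Build K (free_smod K S n)
  (free_smod K S' n.+1) _ (@prism_fun n) (@prism_linear n).
Definition prism n : {linear free_smod K S n -> free_smod K S' n.+1} := @prism_fun n.

Lemma prism_degen n a :
  a \in degen_sub (free_smod K S) n -> prism n a \in degen_sub (free_smod K S') n.+1.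
Proof.
case: n a => [|n] a; first by rewrite inE => /eqP ->; rewrite linear0 rpred0.
move=> /degen_subP[b {a}->]; rewrite linear_sum; apply: rpred_sum => i _.
apply: rpred_sum => j _; apply: rpredZ; rewrite prism_map_aact.
(* [codegen j] sends k and k + 1 to i and i + 1, which [codegen i] identifies, and both stay on the
   same side of the jump between j and j + 1. *)
have k_lt : ((if (j <= i)%N then i.+1 else i) < n.+2)%N.
  by move: (ltn_ord i); case: ifP; lia.
apply: (@prism_map_degen _ _ _ _ (Ordinal k_lt)) => s t sE tE; split; apply: ord_inj.
  by rewrite !mcompE !codegenE sE tE /= /unbump; case: ifP; lia.
by rewrite !stepE sE tE /=; case: ifP; lia.
Qed.

Lemma prism_sub n a :
  a \in free_sub K (@pp_sub S n) -> prism n a \in free_sub K (@pp_sub S' n.+1).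
Proof.
move=> aY; apply: rpred_sum => j _; apply: rpredZ; apply: free_map_sub aY => y Yy.
apply: pp_mapP; apply/diamondP.
(* The step map is its own pullback of the identity 1-simplex, and the two coordinates at t add up
   to t. *)
exists n, 1%N, (codegen j), (step n.+1 j.+1), y, (midm 1); split=> //.
- by rewrite addn1.
- by move=> t; rewrite codegenE stepE /unbump; lia.
by congr pair; apply: monoP => t; rewrite mcompE midmE.
Qed.

(** * The boundary of the prisms *)

Section Boundary.
Variables (n : nat) (a : free_smod K S n).

Definition prism_face (i : 'I_n.+2) (j : 'I_n.+1) : free_smod K S' n :=
  (-1) ^+ (i + j) *:
    prism_map (mcomp (codegen j) (coface i)) (mcomp (step n.+1 j.+1) (coface i)) a.

Lemma unnorm_diff_prism :
  unnorm_diff (free_smod K S') n (prism n a) = \sum_j \sum_i prism_face i j.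
Proof.
rewrite linear_sum; apply: eq_bigr => j _; rewrite linearZ
  [unnorm_diff _ _ _]/(unnorm_diff_fun _) /unnorm_diff_fun /= scaler_sumr.
apply: eq_bigr => i _; rewrite scalerA -exprD addnC.
by congr (_ *: _); exact: aact_prism_map.
Qed.

(** Faces j and j + 1 of prism j are the sections of the cylinder over [step n j] and [step n j.+1],
    with signs + and -, so the sum telescopes. *)
Lemma prism_face_diag :
  \sum_j (prism_face (widen_ord (leqnSn _) j) j + prism_face (lift ord0 j) j) =
  prism_map (midm n) (step n 0) a - prism_map (midm n) (step n n.+1) a.
Proof.
pose P k := prism_map (midm n) (step n k) a.
rewrite -/(P 0%N) -/(P n.+1) -opprB -(telescope_sumr _ (leq0n _)) -sumrN big_mkord.
apply: eq_bigr => j _; rewrite opprB /prism_face /= /bump add1n addSn exprS.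
rewrite addnn -muln2 exprM sqrr_sign mulr1 scaleN1r scale1r.
congr (_ - _); congr (prism_map _ _ a); apply: monoP => t.
- by rewrite mcompE midmE codegenE cofaceE /= /bump /unbump; lia.
- by rewrite mcompE !stepE cofaceE /= /bump; lia.
- by rewrite mcompE midmE codegenE cofaceE /= /bump /unbump; lia.
by rewrite mcompE !stepE cofaceE /= /bump; lia.
Qed.

Lemma prism_face_split :
  \sum_j \sum_i prism_face i j =
  \sum_j (prism_face (widen_ord (leqnSn _) j) j + prism_face (lift ord0 j) j) +
  (\sum_(j < n.+1) \sum_(i < n.+2 | (i < j)%N) prism_face i j +
   \sum_(j < n.+1) \sum_(i < n.+2 | (j.+1 < i)%N) prism_face i j).
Proof.
rewrite -!big_split; apply: eq_bigr => j _ /=.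
rewrite (bigD1 (widen_ord (leqnSn _) j)) //= (bigD1 (lift ord0 j)) /=; last first.
  by rewrite -val_eqE /= /bump; lia.
rewrite addrA (bigID (fun i : 'I_n.+2 => (i < j)%N)) /=; congr (_ + (_ + _)).
  by apply: eq_bigl => i; rewrite -!val_eqE /= /bump; lia.
by apply: eq_bigl => i; rewrite -!val_eqE /= /bump; lia.
Qed.
End Boundary.

Lemma prism_unnorm_diff n (a : free_smod K S n.+1) :
  prism n (unnorm_diff (free_smod K S) n a) =
  \sum_(j < n.+1) \sum_(i < n.+2) (-1) ^+ (i + j) *:
    prism_map (mcomp (coface i) (codegen j)) (step n.+1 j.+1) a.
Proof.
apply: eq_bigr => j _; rewrite [unnorm_diff _ _ _]/(unnorm_diff_fun _).
rewrite /unnorm_diff_fun [prism_map _ _ _]linear_sum scaler_sumr.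
apply: eq_bigr => i _.
by rewrite [prism_map _ _ _]linearZ scalerA -exprD addnC -prism_map_aact.
Qed.

(** Face i of prism j + 1 is prism j of face i when i <= j, and face i + 1 of prism j is prism j of
    face i when i > j. Either shift raises the exponent of the sign by one, whence the minus. *)
Lemma prism_face_off n (a : free_smod K S n.+1) :
  \sum_(j < n.+2) \sum_(i < n.+3 | (i < j)%N) prism_face a i j +
  \sum_(j < n.+2) \sum_(i < n.+3 | (j.+1 < i)%N) prism_face a i j =
  - prism n (unnorm_diff (free_smod K S) n a).
Proof.
(* Prism 0 has no face below the diagonal and the last prism none above it; dropping them lets both
   sums run over the same j. *)
rewrite prism_unnorm_diff big_ord_recl big_pred0 // add0r.
rewrite [X in _ + X]big_ord_recr /= [X in _ + (_ + X)]big_pred0; last first.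
  by move=> i; rewrite ltnNge -ltnS ltn_ord.
rewrite addr0 -big_split -sumrN; apply: eq_bigr => j _ /=.
rewrite -sumrN (bigID (fun i : 'I_n.+2 => (i <= j)%N)) /=.
congr (_ + _).
  rewrite big_mkcond big_ord_recr /= [X in _ + X]ifF; last first.
    by move: (ltn_ord j); rewrite /bump; lia.
  rewrite addr0 -big_mkcond; apply: eq_big => [i|i ij]; first by rewrite /bump; lia.
  rewrite -scaleNr -mulN1r -exprS.
  rewrite /prism_face /= /bump add1n addnS; congr (_ *: prism_map _ _ a).
    apply: monoP => t; rewrite !mcompE !codegenE !cofaceE !codegenE /=.
    by rewrite /bump /unbump; move: ij; rewrite /bump; lia.
  apply: monoP => t; rewrite !mcompE !stepE cofaceE /=.
  by move: ij; rewrite /bump; lia.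
rewrite big_mkcond big_ord_recl /= add0r -big_mkcond.
apply: eq_big => [i|i ij]; first by rewrite /bump; lia.
rewrite -scaleNr -mulN1r -exprS.
rewrite /prism_face /= /bump add1n addSn; congr (_ *: prism_map _ _ a).
  apply: monoP => t; rewrite !mcompE !codegenE !cofaceE !codegenE /=.
  by rewrite /bump /unbump; move: ij; rewrite /bump; lia.
apply: monoP => t; rewrite !mcompE !stepE cofaceE /=.
by move: ij; rewrite /bump; lia.
Qed.

Lemma prism_is_chain_homotopy :
  is_chain_homotopy (unnorm_map (free_smod_map K (pp_comp H (interval_incl S ord0))))
    (unnorm_map (free_smod_map K (pp_comp H (interval_incl S ord_max)))) prism.
Proof.
have diag n (a : free_smod K S n) :
    free_smod_map K (pp_comp H (interval_incl S ord0)) n a -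
    free_smod_map K (pp_comp H (interval_incl S ord_max)) n a =
    \sum_j (prism_face a (widen_ord (leqnSn _) j) j + prism_face a (lift ord0 j) j).
  rewrite prism_face_diag; congr (_ - _); apply/esym/prism_map_end => t.
    by apply: ord_inj; rewrite stepE cofaceE.
  apply: ord_inj; rewrite stepE cofaceE /= /bump.
  by have := ltn_ord t; lia.
(* In degree 0 the only prism has just its two diagonal faces, so both off-diagonal sums are
   empty. *)
split=> [a|n a].
  rewrite [LHS]diag [RHS]unnorm_diff_prism prism_face_split.
  rewrite [X in _ = _ + (X + _)]big1 ?[X in _ = _ + (_ + X)]big1 ?addr0 //.
    by move=> j _; rewrite big_pred0 // => i; have := ltn_ord i; lia.
  by move=> j _; rewrite big_pred0 // => i; have := ltn_ord j; lia.
rewrite [LHS]diag [X in _ = X + _]unnorm_diff_prism prism_face_split.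
by rewrite prism_face_off [X in _ = _ + X]/= subrK.
Qed.
End Prism.

(** * From one-step homotopies to the generated equivalence *)

Lemma one_step_homotopic_chain (K : comPzRingType) (S S' : path_pair)
    (f g : pp_map S S') : one_step_homotopic f g ->
  chain_homotopic (Omega_map K f) (Omega_map K g) /\
  chain_homotopic (Psi_map K f) (Psi_map K g).
Proof.
case=> H [<- <-].
have hP := moore_homotopyP (prism_is_chain_homotopy K H).
have hB n x : x \in pp_bar K S n ->
    moore_homotopy (prism K H) n x \in pp_bar K S' n.+1.
  move=> /rho_subP[b bY ->]; apply/rho_subP; exists (prism K H n b).
    exact: prism_sub.
  exact/moore_homotopy_rho/prism_degen.
by split; [exact: omega_map_homotopic hP hB | exact: psi_map_homotopic hP hB].
Qed.

Theorem proposition9p3 (K : comPzRingType) (S S' : path_pair)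
    (f g : pp_map S S') (fg : homotopic f g) :
  chain_homotopic (Omega_map K f) (Omega_map K g) /\
  chain_homotopic (Psi_map K f) (Psi_map K g).
Proof.
elim: fg => {f g} [f g|f|f g _ [? ?]|f g h _ [fg fg'] _ [gh gh']].
- exact: one_step_homotopic_chain.
- by split; exact: chain_homotopic_refl.
- by split; exact: chain_homotopic_sym.
by split; [exact: chain_homotopic_trans fg gh | exact: chain_homotopic_trans fg' gh'].
Qed.
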